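(* Let $n\ge1$ and let $\psi_\omega(z)=\sum_{j\in\mathbb{N}^n}\omega_j\frac{z_1^{j_1}z_2^{j_2}\cdots z_n^{j_n}}{\sqrt{j_1!\,j_2!\cdots j_n!}}$, $z\in\mathbb{C}^n$, where $(\omega_j)_{j\in\mathbb{N}^n}$ are independent identically distributed standard complex Gaussian random variables. Let $$\mathrm{Hole}_r=\{\omega:\forall z\in B(0,r),\ \psi_\omega(z)\ne0\}.$$ Then there exist $R_n$, $c_1>0$ and $c_2>0$ such that for all $r>R_n$ $$e^{-c_2r^{2n+2}}\le\mathrm{Prob}(\mathrm{Hole}_r)\le e^{-c_1r^{2n+2}}.$$
   Context: $\mathbb{N}=\{0,1,2,\dots\}$. A standard complex Gaussian random variable has mean $0$, variance $E[|\omega|^2]=1$, and density $\frac1\pi e^{-|x|^2}$ on $\mathbb{C}$. Almost surely the series $\psi_\omega$ defines a holomorphic function on $\mathbb{C}^n$. $B(0,r)=\{z\in\mathbb{C}^n:|z|<r\}$ for the Euclidean norm. *)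

(* Defs.v *)
(* MathComp-Analysis; complex numbers are R[i] from real-closed, over an
   abstract R : realType. *)
From HB Require Import structures.
From mathcomp Require Import all_boot all_order all_algebra finmap.
From mathcomp Require Import all_classical all_reals all_analysis.
From mathcomp Require Import showcase.summability.
From mathcomp Require Import complex.

Set Implicit Arguments.
Unset Strict Implicit.
Unset Printing Implicit Defensive.

Import Order.TTheory GRing.Theory Num.Theory.
Import numFieldNormedType.Exports.

Local Open Scope classical_set_scope.
Local Open Scope ring_scope.
Local Open Scope complex_scope.

Definition multi_index (n : nat) := {ffun 'I_n -> nat}.

(* R[i] carries no sigma-algebra in the library: measurability of complex
   random variables goes through C = R^2, with the Borel sets of the plane. *)
Definition plane (R : realType) (z : R[i]) :
    measurableTypeR R * measurableTypeR R :=
  (complex.Re z, complex.Im z).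

Definition standard_complex_gaussian (R : realType) (d : measure_display)
    (T : measurableType d) (P : probability T R) (X : T -> R[i]) : Prop :=
  measurable_fun setT (@plane R \o X) /\
  forall A : set (measurableTypeR R * measurableTypeR R), measurable A ->
    P ((@plane R \o X) @^-1` A) =
    (\int[lebesgue_measure \x lebesgue_measure]_(x in A)
        (pi^-1 * expR (- (x.1 ^+ 2 + x.2 ^+ 2)))%:E)%E.

Definition mutually_independent (R : realType) (d : measure_display)
    (T : measurableType d) (P : probability T R) (I : choiceType)
    (X : I -> T -> R[i]) : Prop :=
  forall (J : {fset I}) (A : I -> set (measurableTypeR R * measurableTypeR R)),
    (forall j, measurable (A j)) ->
    P (\bigcap_(j in [set` J]) ((@plane R \o X j) @^-1` A j)) =
    (\prod_(j <- J) P ((@plane R \o X j) @^-1` A j))%E.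

(* The sum over the unordered countable set N^n is the limit of the partial
   sums along the directed set of finite subsets of N^n, which over the complex
   numbers exists exactly when the series converges absolutely. *)
Definition psi (R : realType) (n : nat) (T : Type)
    (omega : multi_index n -> T -> R[i]) (t : T) (z : 'rV[R[i]]_n) : R[i] :=
  sum (fun j : multi_index n =>
    omega j t *
      ((\prod_(i < n) z 0 i ^+ j i) /
       (Num.sqrt (\prod_(i < n) ((j i)`!)%:R))%:C) : R[i]^o).

(* The norm that the library puts on row vectors is the sup norm. *)
Definition euclidean_norm (R : realType) (n : nat) (z : 'rV[R[i]]_n) : R :=
  Num.sqrt (\sum_(i < n) ComplexField.Normc.normc (z 0 i) ^+ 2).

(* Where the partial sums have no limit, [sum] takes the default value 0, so a
   sample point at which the series diverges somewhere in the ball is not in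
   [hole]; such sample points form a null set. *)
Definition hole (R : realType) (n : nat) (T : Type)
    (omega : multi_index n -> T -> R[i]) (r : R) : set T :=
  [set t | forall z : 'rV[R[i]]_n, euclidean_norm z < r -> psi omega t z != 0].

(* Main.v *)
(* A zero-free psi on the ball of radius r is controlled through the logarithmic
   derivative of its slices t |-> psi (t z), |z_i| = 1. Truncations of psi have no
   zeros on a polydisc of radius rho ~ r (compactness), so a slice is
   psi(0) * prod_k (1 - x_k t) with |x_k| < 1 / rho. Since psi has order of growth
   two outside an event of tiny probability, counting zeros in dyadic shells bounds
   the power sums sum_k x_k^m by D / rho^m, D polynomial in r, for m >= 3. Newton's
   identities and Cauchy's estimate on the torus then confine each coefficient of
   degree m, given those of lower degree, to a disc of radius O(D |psi(0)| / rho^m).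
   In terms of omega_j the radius is at most O(D |psi(0)| 4^-|j|) as long as
   |j| <= c r^2. Multiplying the probabilities of these discs over the ~ r^(2n) such
   indices gives exp (- c r^(2n+2)); a union bound over the cells of a fine grid
   replaces conditioning.

   For the lower bound, psi has no zeros in the ball when |omega_0| >= 2,
   |omega_j| <= exp (- K r^2) for 0 < |j| <= K r^2, and |omega_j| <= 2^|j| beyond. *)
Require Import Defs.
From HB Require Import structures.
From mathcomp Require Import all_boot all_order all_algebra finmap.
From mathcomp Require Import all_classical all_reals all_analysis.
From mathcomp Require Import measurable_realfun showcase.summability.
From mathcomp Require Import complex ring lra zify.

Set Implicit Arguments.
Unset Strict Implicit.
Unset Printing Implicit Defensive.

Import Order.TTheory GRing.Theory Num.Theory.
Import numFieldNormedType.Exports.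
Import ComplexField.Normc.

Local Open Scope classical_set_scope.
Local Open Scope ring_scope.
Local Open Scope complex_scope.

(** * Polynomials in one complex variable *)

(** Growth of order two allows about [4 ^ q] zeros in the [q]-th dyadic shell, which is why power
    sums are bounded, uniformly in the truncation, only from degree [3] on. The upper bound rests on
    a balance. With [|psi(0)| <= u = exp (eps r^2)], the roughly [r^(2n)] discs lose a factor
    exponential in a multiple of [eps r^(2n+2)], the order of the gain from the factors [4^-|j|]; so
    [eps] must be small against the constant of that gain. The requirement
    [|psi(0)| >= exp (- r^(2n+2))] is affordable: it fails with probability of order
    [exp (- 2 r^(2n+2))] and enters [D] only through its logarithm. The stability constants of
    Newton's identities are left without explicit control, because they influence nothing but the
    mesh of the grid, which cancels. *)

Section ComplexModulus.
Context {R : rcfType}.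
Implicit Types (x y z : R[i]).

Lemma normrC z : `|z| = (normc z)%:C.
Proof. by case: z. Qed.

Lemma normc_ge0 z : 0 <= normc z.
Proof. by case: z => a b /=; exact: sqrtr_ge0. Qed.

Lemma normc0_eq : normc (0 : R[i]) = 0. Proof. exact: normc0. Qed.
Lemma normc1_eq : normc (1 : R[i]) = 1. Proof. exact: normc1. Qed.

Lemma normc_eq0 z : (normc z == 0) = (z == 0).
Proof.
by apply/eqP/eqP => [/eq0_normc//|->]; rewrite normc0_eq.
Qed.

Lemma normc_gt0 z : (0 < normc z) = (z != 0).
Proof. by rewrite lt_def normc_ge0 andbT normc_eq0. Qed.

Lemma ler_normcD x y : normc (x + y) <= normc x + normc y.
Proof. exact: le_normcD. Qed.

Lemma normc_opp x : normc (- x) = normc x.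
Proof. exact: normcN. Qed.

Lemma normcBC x y : normc (x - y) = normc (y - x).
Proof. by rewrite -normc_opp opprB. Qed.

Lemma ler_normcB x y : normc (x - y) <= normc x + normc y.
Proof. by rewrite -(normc_opp y); exact: ler_normcD. Qed.

Lemma lerB_normc x y : normc x - normc y <= normc (x - y).
Proof.
by rewrite lerBlDr -[X in normc X <= _](subrK y); exact: ler_normcD.
Qed.

Lemma ler_dist_normc x y : `|normc x - normc y| <= normc (x - y).
Proof.
rewrite ler_norml lerB_normc andbT lerNl opprB normcBC.
exact: lerB_normc.
Qed.

Lemma normcX x n : normc (x ^+ n) = normc x ^+ n.
Proof.
elim: n => [|n IH]; first by rewrite !expr0 normc1_eq.
by rewrite !exprS normcM IH.
Qed.

Lemma ler_normc_sum (I : Type) (r : seq I) (P : pred I) (F : I -> R[i]) :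
  normc (\sum_(i <- r | P i) F i) <= \sum_(i <- r | P i) normc (F i).
Proof.
elim/big_rec2 : _ => [|i a b _ H]; first by rewrite normc0_eq.
by apply: (le_trans (ler_normcD _ _)); rewrite lerD2l.
Qed.

Lemma normc_prod (I : Type) (r : seq I) (P : pred I) (F : I -> R[i]) :
  normc (\prod_(i <- r | P i) F i) = \prod_(i <- r | P i) normc (F i).
Proof.
elim/big_rec2 : _ => [|i a b _ H]; first by rewrite normc1_eq.
by rewrite normcM H.
Qed.

Lemma normc_real (a : R) : normc a%:C = `|a|.
Proof. by rewrite /normc /= expr0n addr0 sqrtr_sqr. Qed.

Lemma normc_nat (k : nat) : normc (k%:R : R[i]) = k%:R.
Proof.
by rewrite -(rmorph_nat (real_complex R)) normc_real ger0_norm.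
Qed.

Lemma normc_sqr z : normc z ^+ 2 = complex.Re z ^+ 2 + complex.Im z ^+ 2.
Proof. by case: z => a b /=; rewrite sqr_sqrtr// addr_ge0// sqr_ge0. Qed.

Lemma normRe_le z : `|complex.Re z| <= normc z.
Proof.
rewrite -(ler_sqr (x := `|_|)) ?nnegrE ?normc_ge0// normc_sqr.
by rewrite real_normK ?num_real// lerDl sqr_ge0.
Qed.

Lemma normIm_le z : `|complex.Im z| <= normc z.
Proof.
rewrite -(ler_sqr (x := `|_|)) ?nnegrE ?normc_ge0// normc_sqr.
by rewrite real_normK ?num_real// lerDr sqr_ge0.
Qed.

Lemma normc_leD z : normc z <= `|complex.Re z| + `|complex.Im z|.
Proof.
rewrite -ler_sqr ?nnegrE ?normc_ge0 ?addr_ge0// normc_sqr sqrrD.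
by rewrite !real_normK ?num_real// lerD2r lerDl mulrn_wge0// mulr_ge0.
Qed.

End ComplexModulus.

Section PolynomialOnCircle.
Context {R : rcfType}.
Implicit Types (p q : {poly R[i]}) (z : R[i]).

(** The two parts at [z ^+ 2] are, up to the factor [z], the half sum and the half difference of [p]
    at [z] and [- z]. *)
Lemma normc_even_part_le p z :
  normc (even_poly p).[z ^+ 2] <= Num.max (normc p.[z]) (normc p.[- z]) /\
  normc z * normc (odd_poly p).[z ^+ 2]
    <= Num.max (normc p.[z]) (normc p.[- z]).
Proof.
set e := (even_poly p).[z ^+ 2]; set o := (odd_poly p).[z ^+ 2].
have pz : p.[z] = e + o * z.
  by rewrite -{1}(poly_even_odd p) hornerD hornerM !horner_comp hornerXn hornerX.
have pNz : p.[- z] = e - o * z.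
  rewrite -{1}(poly_even_odd p) hornerD hornerM !horner_comp hornerXn hornerX.
  by rewrite sqrrN mulrN.
have two w : normc (w + w) = normc w * 2.
  by rewrite (_ : w + w = w * 2%:R) ?normcM ?normc_nat// mulr_natr mulr2n.
split.
  have : normc e * 2 <= normc p.[z] + normc p.[- z].
    rewrite -two (_ : e + e = p.[z] + p.[- z]); last by rewrite pz pNz; ring.
    exact: ler_normcD.
  by rewrite le_max; case: (leP (normc e) (normc p.[z])) => //= h1 h2; lra.
have : normc (o * z) * 2 <= normc p.[z] + normc p.[- z].
  rewrite -two (_ : o * z + o * z = p.[z] - p.[- z]); last by rewrite pz pNz; ring.
  exact: ler_normcB.
rewrite normcM mulrC [X in _ -> X <= _]mulrC.
by rewrite le_max; case: (leP (normc o * normc z) (normc p.[z])) => //= h1 h2; lra.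
Qed.

(* Splitting [p] into its even and odd parts halves the degree: a point [w]
   where one part is large yields [z] with [z ^+ 2 = w], and [p] is at least as
   large at [z] or at [- z]. *)
Lemma coef_le_on_circle p k (s : R) : 0 < s ->
  exists2 z : R[i], normc z = s & normc p`_k * s ^+ k <= normc p.[z].
Proof.
move: {2}(size p) (leqnn (size p)) => n.
elim/ltn_ind : n p k s => -[_ |[_ |n IH]] p k s szp s0.
- move: szp; rewrite leqn0 size_poly_eq0 => /eqP ->.
  exists s%:C; first by rewrite normc_real gtr0_norm.
  by rewrite coef0 normc0_eq mul0r normc_ge0.
(* Constants form a base case of their own: [uphalf 1 = 1], so halving would not shorten them. *)
- rewrite (size1_polyC szp); exists s%:C; first by rewrite normc_real gtr0_norm.
  rewrite coefC hornerC; have [->|_] := eqVneq k 0%N; first by rewrite expr0 mulr1.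
  by rewrite normc0_eq mul0r normc_ge0.
have half_lt : (uphalf n.+2 < n.+2)%N.
  by rewrite /= ltnS uphalf_half; case: n {IH szp} => [//|n]; lia.
have [q [szq qP [qk]]] : exists q, [/\ (size q <= uphalf n.+2)%N,
    forall z, normc z = s -> s ^+ odd k * normc q.[z ^+ 2]
      <= Num.max (normc p.[z]) (normc p.[- z])
    & q`_(k./2) = p`_k].
  case ok: (odd k).
    exists (odd_poly p); split.
    - apply: (leq_trans (size_odd_poly p)).
      by apply: leq_trans (half_leq szp) _; rewrite uphalf_half; lia.
    - by move=> z <-; have [] := normc_even_part_le p z.
    - by rewrite coef_odd_poly; congr (_`_ _); have := odd_double_half k; rewrite ok.
  exists (even_poly p); split.
  - by apply: (leq_trans (size_even_poly p)); rewrite uphalf_leq.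
  - by move=> z _; rewrite expr0 mul1r; have [] := normc_even_part_le p z.
  - by rewrite coef_even_poly; congr (_`_ _); have := odd_double_half k; rewrite ok.
have [w ws wP] := IH _ half_lt q k./2 (s ^+ 2) szq (exprn_gt0 2 s0).
have zs : normc (sqrtc w) = s.
  apply/eqP; rewrite -(eqrXn2 (n := 2))// ?normc_ge0 ?(ltW s0)//.
  by rewrite -normcX sqr_sqrtc ws.
have := qP _ zs; rewrite sqr_sqrtc le_max => qP'.
have key : normc p`_k * s ^+ k <= s ^+ odd k * normc q.[w].
  have -> : s ^+ k = s ^+ odd k * (s ^+ 2) ^+ k./2.
    by rewrite -exprM mul2n -exprD odd_double_half.
  by rewrite mulrCA ler_pM2l ?exprn_gt0// -qk.
case/orP: qP' => qP'; [exists (sqrtc w)|exists (- sqrtc w)];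
  rewrite ?normc_opp//; exact: le_trans key qP'.
Qed.

End PolynomialOnCircle.

(** * Inverse zeros, their power sums and their number *)

Section PowerSums.
Context {R : realType}.
Implicit Types (F : {poly R[i]}) (xs : seq R[i]).

(** For [m > 0] this is the coefficient of [z ^ m] in [- z G' / G], where [G] is
    [zero_inverses_poly xs]. *)
Definition power_sum xs m : R[i] := \sum_(x <- xs) x ^+ m.

Definition zero_inverses_poly xs : {poly R[i]} := \prod_(x <- xs) (1 - x *: 'X).

Lemma horner_zero_inverses xs z :
  (zero_inverses_poly xs).[z] = \prod_(x <- xs) (1 - x * z).
Proof.
rewrite /zero_inverses_poly horner_prod; apply: eq_bigr => x _.
by rewrite hornerD hornerN hornerZ hornerX hornerC.
Qed.

Lemma poly_zero_inverses F (rho : R) : 0 < rho ->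
  (forall z, normc z <= rho -> F.[z] != 0) ->
  exists xs, F = F`_0 *: zero_inverses_poly xs /\
    {in xs, forall x, normc x * rho < 1}.
Proof.
move=> rho0 Fneq0; have [r rP] := closed_field_poly_normal F.
have lc0 : lead_coef F != 0.
  rewrite lead_coef_eq0; apply/eqP => F0.
  by have := Fneq0 0; rewrite normc0_eq (ltW rho0) F0 horner0 eqxx => /(_ isT).
have rroot a : a \in r -> rho < normc a.
  move=> ar; rewrite ltNge; apply/negP => /Fneq0; apply/negP; rewrite negbK.
  by rewrite rP hornerZ -/(root _ _) mulf_eq0 -/(root _ _) root_prod_XsubC ar orbT.
have r0 a : a \in r -> a != 0.
  by move=> /rroot ra; rewrite -normc_gt0 (lt_trans rho0 ra).
exists [seq a^-1 | a <- r]; split; last first.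
  move=> _ /mapP[a ar ->]; rewrite normcV mulrC ltr_pdivrMr ?mul1r ?rroot//.
  by rewrite normc_gt0 r0.
have E : F = (lead_coef F * \prod_(a <- r) (- a)) *:
    zero_inverses_poly [seq a^-1 | a <- r].
  rewrite {1}rP -scalerA; congr (_ *: _).
  rewrite /zero_inverses_poly big_map -scaler_prod; apply: eq_big_seq => a /r0 a0.
  by rewrite scalerBr scalerA mulNr divff// scaleN1r opprK alg_polyC polyCN addrC.
suff F0 : F`_0 = lead_coef F * \prod_(a <- r) (- a) by rewrite F0.
rewrite -horner_coef0 {1}E hornerZ horner_zero_inverses.
rewrite [X in _ * X = _]big1 ?mulr1//.
by move=> x _; rewrite mulr0 subr0.
Qed.

(** These are the coefficients of [z F' = F * (z F' / F)]. Induction on the list of zeros gives all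
    [k] at once, those beyond the degree included. *)
Lemma newton_identity (c : R[i]) xs k (F := c *: zero_inverses_poly xs) :
  F`_k *+ k = - \sum_(i < k) F`_i * power_sum xs (k - i).
Proof.
rewrite {}/F; elim: xs k => [|x xs IH] k.
  rewrite /zero_inverses_poly big_nil big1 ?oppr0.
    by rewrite coefZ coef1; case: k => [|k]//=; rewrite mulr0 mul0rn.
  by move=> i _; rewrite /power_sum big_nil mulr0.
set P := zero_inverses_poly xs in IH *.
have GE j : (c *: zero_inverses_poly (x :: xs))`_j.+1 =
    (c *: P)`_j.+1 - x * (c *: P)`_j.
  rewrite /zero_inverses_poly big_cons -/P mulrBl mul1r -scalerAl !coefZ coefB.
  by rewrite coefZ coefXM /=; ring.
have GE0 : (c *: zero_inverses_poly (x :: xs))`_0 = (c *: P)`_0.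
  rewrite /zero_inverses_poly big_cons -/P mulrBl mul1r -scalerAl !coefZ coefB.
  by rewrite coefZ coefXM /= mulr0 subr0.
have psE m : power_sum (x :: xs) m = power_sum xs m + x ^+ m.
  by rewrite /power_sum big_cons addrC.
case: k => [|k]; first by rewrite mulr0n big_ord0 oppr0.
set G := c *: zero_inverses_poly (x :: xs) in GE GE0 *.
set F := c *: P in IH GE GE0 *.
(* [F] is [G] times the geometric series in [x *: 'X], the inverse of the new factor. *)
have telescope j : (j <= k)%N ->
    \sum_(i < j.+1) G`_i * x ^+ (k.+1 - i) = F`_j * x ^+ (k.+1 - j).
  elim: j => [_|j IHj jk]; first by rewrite big_ord_recl big_ord0 addr0 GE0.
  rewrite big_ord_recr/= IHj ?(ltnW jk)// GE.
  have -> : (k.+1 - j = (k.+1 - j.+1).+1)%N by lia.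
  by rewrite exprS; ring.
have shifted : \sum_(i < k.+1) G`_i * power_sum xs (k.+1 - i) =
    \sum_(i < k.+1) F`_i * power_sum xs (k.+1 - i)
    - x * \sum_(i < k) F`_i * power_sum xs (k - i).
  rewrite big_ord_recl GE0 [X in _ = X - _]big_ord_recl/= -addrA; congr (_ + _).
  rewrite mulr_sumr -sumrB; apply: eq_bigr => i _.
  by rewrite /bump/= add1n GE subSS; ring.
under eq_bigr do rewrite psE mulrDr.
rewrite big_split/= shifted telescope// subSnn expr1 GE.
have := IH k.+1; have := IH k.
move=> /(congr1 -%R); rewrite opprK => <-.
move=> /(congr1 -%R); rewrite opprK => <-.
by ring.
Qed.

(** Invert and square [exp (- 1 / 2) >= 1 / 2]. The value [4 = 5 - 1] dictates the radius [5 * s] in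
    [zero_count_le]. *)
Lemma expR1_le4 : expR 1 <= 4 :> R.
Proof.
have h : 2^-1 <= expR (- 2^-1) :> R.
  by have := expR_ge1Dx (- 2^-1 : R); lra.
have -> : expR 1 = ((expR (- 2^-1))^-1) ^+ 2 :> R.
  by rewrite -expRN opprK -expRM_natl; congr expR; lra.
have h2 : (expR (- 2^-1))^-1 <= 2 :> R.
  by rewrite -[leRHS]invrK lef_pV2// posrE ?expR_gt0//.
have -> : 4 = 2 ^+ 2 :> R by lra.
by rewrite ler_sqr ?nnegrE ?invr_ge0 ?expR_ge0.
Qed.

(* On a circle of radius [5 * s] each factor whose zero lies in the disc of
   radius [s] is at least [4], and the product of the other factors reaches its
   value [1] at the origin. *)
Lemma zero_count_le xs (s B : R) : 0 < s ->
  (forall z, normc z = 5 * s ->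
     normc (zero_inverses_poly xs).[z] <= expR B) ->
  (count (fun x => 1 <= normc x * s) xs)%:R <= B.
Proof.
move=> s0 bnd; set near_zero := fun x : R[i] => 1 <= normc x * s.
pose G := zero_inverses_poly [seq x <- xs | ~~ near_zero x].
have s5 : 0 < 5 * s by rewrite mulr_gt0.
(* For the coefficient of degree [0] this is the maximum principle. *)
have [z zs] := coef_le_on_circle G 0 s5.
rewrite expr0 mulr1 -horner_coef0 horner_zero_inverses.
rewrite big1 ?normc1_eq => [Gz|x _]; last by rewrite mulr0 subr0.
have := bnd z zs.
rewrite horner_zero_inverses (bigID near_zero)/= normcM.
rewrite horner_zero_inverses big_filter in Gz => Fz.
have : expR (count near_zero xs)%:R <= expR B :> R.
  apply: le_trans Fz; rewrite -[leLHS]mulr1; apply: ler_pM => //.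
  rewrite normc_prod -[X in expR X]mulr1 expRM_natl.
  rewrite -iter_mulr_1 -(big_const_seq _ _ _ near_zero).
  apply: ler_prod => x near_x; rewrite expR_ge0/=; apply: le_trans expR1_le4 _.
  rewrite normcBC; apply: le_trans (lerB_normc _ _); rewrite normc1_eq normcM zs.
  by move: near_x; rewrite /near_zero; lra.
by rewrite ler_expR.
Qed.

(* The sum has a nonzero term for the dyadic shell containing [y], if that is one
   of the first [Q] shells. *)
Lemma cube_le_dyadic (y : R) Q : 0 <= y < 1 ->
  y ^+ 3 <= \sum_(q < Q) 8^-1 ^+ q *+ (1 <= y * 2 ^+ q.+1)%R + 8^-1 ^+ Q.
Proof.
move=> /andP[y0 y1]; elim: Q => [|Q IH].
  by rewrite big_ord0 add0r expr0 exprn_ile1// ltW.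
rewrite big_ord_recr/=; have [big|small] := leP 1 (y * 2 ^+ Q.+1).
  apply: le_trans IH _; rewrite mulr1n lerDl.
  by rewrite exprn_ge0// invr_ge0.
have h : y ^+ 3 <= 8^-1 ^+ Q.+1.
  have -> : 8^-1 = 2^-1 ^+ 3 :> R by lra.
  rewrite -exprM mulnC exprM; apply: lerXn2r; rewrite ?nnegrE ?exprn_ge0 ?invr_ge0//.
  rewrite exprVn -[leRHS]mul1r ler_pdivlMr ?exprn_gt0//.
  exact: ltW.
apply: le_trans h _; rewrite lerDr addr_ge0//.
  by apply: sumr_ge0 => i _; rewrite mulrn_wge0 ?exprn_ge0 ?invr_ge0.
Qed.

(** Weights [8^-1 ^+ q] against a count of [D * 4 ^+ q.+1] leave a geometric series of sum at most
    [8 * D]. Squares would not offset the count, hence [3 <= m]. *)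
Lemma power_sum_le xs (rho D : R) m : 0 < rho -> (3 <= m)%N ->
  {in xs, forall x, normc x * rho < 1} ->
  (forall q, (count (fun x => (1 <= normc x * (2 ^+ q.+1 * rho))%R) xs)%:R
     <= D * 4 ^+ q.+1) ->
  normc (power_sum xs m) * rho ^+ m <= 8 * D + 1.
Proof.
move=> rho0 m3 xs1 cnt.
have y01 x : x \in xs -> 0 <= normc x * rho < 1.
  by move=> /xs1 ->; rewrite mulr_ge0 ?normc_ge0 ?ltW.
have D0 : 0 <= D.
  by rewrite -(pmulr_lge0 D (_ : 0 < 4 ^+ 1)) ?exprn_gt0//; apply: le_trans (cnt 0%N).
(* As many shells as zeros, so that the [Q] remainders [8^-1 ^+ Q] add up to at most [1]. *)
set Q := size xs.
apply: (@le_trans _ _ (\sum_(x <- xs)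
    (\sum_(q < Q) 8^-1 ^+ q *+ (1 <= normc x * rho * 2 ^+ q.+1)%R + 8^-1 ^+ Q))).
  apply: (@le_trans _ _ (\sum_(x <- xs) (normc x * rho) ^+ m)).
    rewrite -ler_pdivlMr ?exprn_gt0// mulr_suml.
    apply: (le_trans (ler_normc_sum _ _ _)); apply: ler_sum => x _.
    by rewrite normcX exprMn mulfK// expf_neq0// gt_eqF.
  rewrite big_seq [leRHS]big_seq; apply: ler_sum => x xxs; apply: le_trans (cube_le_dyadic _ (y01 _ xxs)).
  by case/andP: (y01 _ xxs) => a b; rewrite ler_wiXn2l// ltW.
rewrite big_split/= exchange_big/=; apply: lerD.
  apply: (@le_trans _ _ (\sum_(q < Q) (4 * D) * 2^-1 ^+ q)).
    apply: ler_sum => q _.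
    under eq_bigr do rewrite mulrb.
    rewrite -big_mkcond/= big_const_seq iter_addr_0 -[leLHS]mulr_natr.
    apply: (@le_trans _ _ (8^-1 ^+ q * (D * 4 ^+ q.+1))).
      rewrite ler_wpM2l ?exprn_ge0 ?invr_ge0//; apply: le_trans (cnt q).
      rewrite ler_nat; apply: eq_leq; apply: eq_count => x.
      by rewrite -mulrA [rho * _]mulrC.
    rewrite exprS (_ : 8^-1 ^+ q = 2^-1 ^+ q * 4^-1 ^+ q :> R); last first.
      by rewrite -exprMn; congr (_ ^+ _); lra.
    have -> : 2^-1 ^+ q * 4^-1 ^+ q * (D * (4 * 4 ^+ q)) =
      4 * D * 2^-1 ^+ q * (4^-1 ^+ q * 4 ^+ q) :> R by ring.
    rewrite -exprMn mulVf// expr1n mulr1//.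
  rewrite -mulr_sumr (_ : 8 * D = 4 * D * 2); last by ring.
  rewrite ler_wpM2l ?mulr_ge0//.
  have : (2^-1 - 1) * \sum_(i < Q) 2^-1 ^+ i = 2^-1 ^+ Q - 1 :> R.
    by rewrite -subrX1.
  have : 0 <= 2^-1 ^+ Q :> R by rewrite exprn_ge0.
  by lra.
rewrite big_const_seq count_predT iter_addr_0 -/Q -[leLHS]mulr_natr.
rewrite exprVn mulrC ler_pdivrMr ?exprn_gt0// mul1r -natrX ler_nat.
by apply: ltnW; apply: ltn_expl.
Qed.

End PowerSums.

(** * Multi-indices, monomials and slices *)

Section MultiIndices.
Context {n : nat}.
Implicit Types (j : multi_index n) (s : seq (multi_index n)).

Definition total_degree j := (\sum_(i < n) j i)%N.

Definition box N : seq (multi_index n) :=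
  [seq [ffun i => g i : nat] | g : {ffun 'I_n -> 'I_N.+1}].

Definition homog m : seq (multi_index n) :=
  [seq j <- box m | total_degree j == m].

(* Listed by increasing degree. *)
Definition simplex M : seq (multi_index n) :=
  flatten [seq homog m | m <- iota 0 M.+1].

Lemma mem_box N j : (j \in box N) = [forall i, (j i <= N)%N].
Proof.
apply/mapP/forallP => [[g _ ->] i|jN].
  by rewrite ffunE -ltnS.
exists [ffun i => inord (j i)]; first by rewrite mem_enum.
by apply/ffunP => i; rewrite !ffunE inordK// ltnS.
Qed.

Lemma uniq_box N : uniq (box N).
Proof.
rewrite map_inj_uniq ?enum_uniq// => g h /ffunP E; apply/ffunP => i.
by apply: val_inj; have := E i; rewrite !ffunE.
Qed.

Lemma index_le_degree j i : (j i <= total_degree j)%N.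
Proof. by rewrite /total_degree (bigD1 i)//= leq_addr. Qed.

Lemma mem_homog m j : (j \in homog m) = (total_degree j == m).
Proof.
rewrite mem_filter mem_box andb_idr// => /eqP <-.
by apply/forallP => i; exact: index_le_degree.
Qed.

Lemma uniq_homog m : uniq (homog m).
Proof. by rewrite filter_uniq// uniq_box. Qed.

Lemma mem_simplex M j : (j \in simplex M) = (total_degree j <= M)%N.
Proof.
apply/flatten_mapP/idP => [[m]|jM].
  by rewrite mem_iota add0n ltnS mem_homog => /= mM /eqP ->.
by exists (total_degree j); rewrite ?mem_homog// mem_iota.
Qed.

Lemma simplexS M : simplex M.+1 = simplex M ++ homog M.+1.
Proof. by rewrite /simplex -[M.+2]addn1 iotaD map_cat flatten_cat/= cats0. Qed.

Lemma uniq_simplex M : uniq (simplex M).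
Proof.
elim: M => [|M IH]; first by rewrite /simplex/= cats0 uniq_homog.
rewrite simplexS cat_uniq IH uniq_homog andbT/=.
by apply/hasPn => j; rewrite mem_homog mem_simplex => /eqP ->; rewrite ltnn.
Qed.

Lemma big_simplex (A : Type) (idx : A) (op : Monoid.law idx) M
    (F : multi_index n -> A) :
  \big[op/idx]_(j <- simplex M) F j =
  \big[op/idx]_(m < M.+1) \big[op/idx]_(j <- homog m) F j.
Proof.
elim: M => [|M IH].
  by rewrite big_ord_recl big_ord0 /simplex/= cats0 Monoid.mulm1.
by rewrite simplexS big_cat IH [RHS]big_ord_recr.
Qed.

Lemma size_box N : size (box N) = (N.+1 ^ n)%N.
Proof. by rewrite size_map -cardE card_ffun !card_ord. Qed.

Lemma size_simplex_le M : (size (simplex M) <= M.+1 ^ n)%N.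
Proof.
rewrite -size_box; apply: uniq_leq_size; first exact: uniq_simplex.
move=> j; rewrite mem_simplex mem_box => jM; apply/forallP => i.
exact: leq_trans (index_le_degree _ _) jM.
Qed.

Lemma sum_box_prod (K : comNzRingType) N (g : 'I_n -> nat -> K) :
  \sum_(j <- box N) \prod_i g i (j i) = \prod_i \sum_(k < N.+1) g i k.
Proof.
rewrite bigA_distr_bigA/= big_map -big_enum; apply: eq_bigr => h _.
by apply: eq_bigr => i _; rewrite ffunE.
Qed.

Lemma sub_box s : exists N, {subset s <= box N}.
Proof.
exists (\max_(j <- s) total_degree j)%N => j js; rewrite mem_box.
apply/forallP => i; apply: leq_trans (index_le_degree _ _) _.
exact: leq_bigmax_seq.
Qed.

Lemma sub_simplex s : exists N, {subset s <= simplex N}.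
Proof.
exists (\max_(j <- s) total_degree j)%N => j js; rewrite mem_simplex.
exact: leq_bigmax_seq.
Qed.

Lemma ler_sum_sub (R : numDomainType) (I : eqType) (s t : seq I) (g : I -> R) :
  uniq s -> {subset s <= t} -> (forall x, 0 <= g x) ->
  \sum_(x <- s) g x <= \sum_(x <- t) g x.
Proof.
move=> us st g0; apply: (@le_trans _ _ (\sum_(x <- undup t) g x)).
  rewrite [leRHS](bigID (mem s))/= -[X in _ <= X + _]big_filter.
  rewrite (perm_big [seq x <- undup t | x \in s]).
    by rewrite lerDl sumr_ge0.
  apply: uniq_perm; rewrite ?filter_uniq ?undup_uniq// => x.
  rewrite mem_filter mem_undup; case: (boolP (x \in s)) => //= xs.
  by rewrite st.
elim: t {st} => //= i t IH; rewrite big_cons; case: ifP => _.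
  by apply: (le_trans IH); rewrite lerDr.
by rewrite big_cons lerD2l.
Qed.

Lemma prod_exp_degree (K : comNzRingType) (c : K) j :
  \prod_i c ^+ j i = c ^+ total_degree j.
Proof. by rewrite prodrXr. Qed.

(** Over a box the sum factors into [n] geometric series, each at most [2]. This is the majorant
    behind all sums over indices below. *)
Lemma sum_geometric_le (R : realFieldType) s : uniq s ->
  \sum_(j <- s) 2^-1 ^+ total_degree j <= 2 ^+ n :> R.
Proof.
move=> us; have [N sN] := sub_box s.
apply: (le_trans (ler_sum_sub us sN _)).
  by move=> j; rewrite exprn_ge0 ?invr_ge0.
under eq_bigr do rewrite -prod_exp_degree.
rewrite (sum_box_prod N (fun _ k => 2^-1 ^+ k)).
rewrite -[X in _ <= _ ^+ X]card_ord -prodr_const; apply: ler_prod => i _.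
rewrite sumr_ge0/= => [|k _]; last by rewrite exprn_ge0 ?invr_ge0.
have : (2^-1 - 1) * \sum_(i < N.+1) 2^-1 ^+ i = 2^-1 ^+ N.+1 - 1 :> R.
  by rewrite -subrX1.
have : 0 <= 2^-1 ^+ N.+1 :> R by rewrite exprn_ge0 ?invr_ge0.
by lra.
Qed.

End MultiIndices.

Section Monomials.
Context {R : realType} {n : nat}.
Implicit Types (j : multi_index n) (s : seq (multi_index n)).

Definition monomial (K : comNzRingType) (z : 'I_n -> K) j : K :=
  \prod_i z i ^+ j i.

Definition weight j : R := (Num.sqrt (\prod_(i < n) ((j i)`!)%:R))^-1.

Lemma weight_gt0 j : 0 < weight j.
Proof.
rewrite invr_gt0 sqrtr_gt0; apply: prodr_gt0 => i _.
by rewrite ltr0n fact_gt0.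
Qed.

Lemma weight_le1 j : weight j <= 1.
Proof.
rewrite /weight invf_le1; last by rewrite -invr_gt0; exact: weight_gt0.
rewrite -[leLHS]sqrtr1 ler_wsqrtr//.
by rewrite -natr_prod ler1n prodn_gt0// => i; rewrite fact_gt0.
Qed.

Lemma expr_le_expR (x : R) k : 0 <= x -> x ^+ k <= k`!%:R * expR x.
Proof.
move=> x0; case: k => [|k].
  by rewrite expr0 fact0 mul1r -expR0 ler_expR.
have := expR_ge1Dxn k x0; rewrite -ler_pdivrMl ?ltr0n ?fact_gt0// => h.
by rewrite mulrC; apply: le_trans h; rewrite lerDr.
Qed.

(** After squaring, the left side is the product of the [x ^ (2 j_i) / j_i!], each a single term of
    the series of [exp (x ^ 2)]. *)
Lemma expr_weight_le (x : R) j : 0 <= x ->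
  x ^+ total_degree j * weight j <= expR (n%:R * x ^+ 2 / 2).
Proof.
move=> x0; have w0 := weight_gt0 j.
rewrite -ler_sqr ?nnegrE ?mulr_ge0 ?exprn_ge0 ?expR_ge0 ?(ltW w0)//.
rewrite -expRM_natl (_ : 2%:R * _ = n%:R * x ^+ 2); last by field.
rewrite exprMn /weight exprVn sqr_sqrtr; last by apply: prodr_ge0.
rewrite ler_pdivrMr; last by apply: prodr_gt0 => i _; rewrite ltr0n fact_gt0.
rewrite -exprM mulnC exprM -prod_exp_degree expRM_natl mulrC.
rewrite -[X in _ * _ ^+ X]card_ord -prodr_const -big_split/=.
apply: ler_prod => i _; rewrite exprn_ge0 ?sqr_ge0//=.
by rewrite expr_le_expR ?sqr_ge0.
Qed.

Lemma normc_monomial_le (z : 'I_n -> R[i]) (r : R) j :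
  (forall i, normc (z i) <= r) ->
  normc (monomial z j) <= r ^+ total_degree j.
Proof.
move=> zr; rewrite normc_prod -prod_exp_degree; apply: ler_prod => i _.
by rewrite normc_ge0 normcX lerXn2r ?nnegrE ?normc_ge0// (le_trans (normc_ge0 _) (zr i)).
Qed.

(** Estimating at radius [b * r] in place of [r] buys the decay [b^-1 ^+ total_degree j] at the
    price of a larger exponential. *)
Lemma monomial_weight_le (z : 'I_n -> R[i]) (r b : R) j : 0 <= r -> 0 < b ->
  (forall i, normc (z i) <= r) ->
  normc (monomial z j) * weight j <=
  b^-1 ^+ total_degree j * expR (n%:R * (b * r) ^+ 2 / 2).
Proof.
move=> r0 b0 zr; apply: (@le_trans _ _ (r ^+ total_degree j * weight j)).
  by rewrite ler_wpM2r ?(ltW (weight_gt0 j))// normc_monomial_le.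
rewrite exprVn ler_pdivlMl ?exprn_gt0// mulrA -exprMn.
by apply: expr_weight_le; rewrite mulr_ge0// ltW.
Qed.

Lemma digits_lt D (a : nat -> nat) k : (forall i, a i < D)%N ->
  (\sum_(i < k) a i * D ^ i < D ^ k)%N.
Proof.
move=> aD; elim: k => [|k IH]; first by rewrite big_ord0.
rewrite big_ord_recr/= expnS; apply: (@leq_trans ((a k).+1 * D ^ k)).
  by rewrite mulSn ltn_add2r.
by rewrite leq_mul2r aD orbT.
Qed.

Lemma digits_inj D (a b : nat -> nat) k :
  (forall i, a i < D)%N -> (forall i, b i < D)%N ->
  (\sum_(i < k) a i * D ^ i = \sum_(i < k) b i * D ^ i)%N ->
  forall i, (i < k)%N -> a i = b i.
Proof.
move=> aD bD; elim: k => [//|k IH]; rewrite !big_ord_recr/= => E.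
have Dk : (0 < D ^ k)%N by rewrite expn_gt0 (leq_ltn_trans _ (aD 0%N)).
have sa := digits_lt k aD; have sb := digits_lt k bD.
have kE : a k = b k.
  have := congr1 (fun x => x %/ D ^ k)%N E.
  by rewrite ![(_ + _ * _)%N]addnC !divnMDl// !divn_small// !addn0.
move=> i; rewrite ltnS leq_eqVlt => /predU1P[->//|]; apply: IH.
by move: E; rewrite kE => /addIn.
Qed.

(* Kronecker substitution [z i = t ^ (D ^ i)], which separates the monomials,
   reduces the estimate to polynomials in one variable. *)
Lemma monomial_coef_le s (c : multi_index n -> R[i]) j0 : uniq s -> j0 \in s ->
  exists2 z : 'I_n -> R[i], forall i, normc (z i) = 1 &
    normc (c j0) <= normc (\sum_(j <- s) c j * monomial z j).
Proof.
move=> us j0s; have [N sN] := sub_box s.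
pose code (j : multi_index n) := (\sum_(i < n) j i * N.+1 ^ i)%N.
have code_inj : {in s &, injective code}.
  move=> j k /sN; rewrite mem_box => /forallP jN /sN; rewrite mem_box => /forallP kN E.
  (* Padding with zeros turns a multi-index into the digit sequence that [digits_inj] expects. *)
  pose ext (l : multi_index n) i := if insub i is Some i' then l i' else 0%N.
  have extE (l : multi_index n) (i : 'I_n) : ext l i = l i.
    by rewrite /ext valK.
  have extN (l : multi_index n) : (forall i, l i <= N)%N -> forall i, (ext l i < N.+1)%N.
    by move=> lN i; rewrite /ext; case: insubP => // i' _ _; rewrite ltnS.
  have codeE l : (\sum_(i < n) ext l i * N.+1 ^ i = code l)%N.
    by apply: eq_bigr => i _; rewrite extE.
  apply/ffunP => i; rewrite -!extE; apply: (digits_inj (extN _ jN) (extN _ kN) _ (ltn_ord i)).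
  by rewrite !codeE.
pose p : {poly R[i]} := \sum_(j <- s) c j *: 'X^(code j).
have [t t1] := @coef_le_on_circle R p (code j0) 1 ltr01.
rewrite expr1n mulr1.
have -> : p`_(code j0) = c j0.
  rewrite /p coef_sum (bigD1_seq j0)//= big_seq_cond big1 => [|j /andP[js jj0]].
    by rewrite coefZ coefXn eqxx mulr1 addr0.
  rewrite coefZ coefXn (inj_in_eq code_inj)// eq_sym (negbTE jj0) mulr0 //.
move=> pt; exists (fun i => t ^+ (N.+1 ^ i)%N).
  by move=> i; rewrite normcX t1 expr1n.
rewrite (_ : \sum_(j <- s) _ = p.[t])// /p horner_sum.
apply: eq_bigr => j _; rewrite hornerZ hornerXn /monomial; congr (_ * _).
rewrite /code -prodrXr; apply: eq_bigr => i _.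
by rewrite -exprM mulnC.
Qed.

End Monomials.

Section Slices.
Context {R : realType} {n : nat}.
Implicit Types (f : multi_index n -> R[i]) (z : 'I_n -> R[i]).

Definition homog_part f m z : R[i] := \sum_(j <- homog m) f j * monomial z j.

Definition truncation f N z : R[i] := \sum_(j <- simplex N) f j * monomial z j.

Definition slice f N z : {poly R[i]} := \poly_(m < N.+1) homog_part f m z.

Lemma coef_slice f N z m : (m <= N)%N -> (slice f N z)`_m = homog_part f m z.
Proof. by move=> mN; rewrite coef_poly ltnS mN. Qed.

Lemma monomialZ (K : comNzRingType) (t : K) (z : 'I_n -> K) j :
  monomial (fun i => t * z i) j = t ^+ total_degree j * monomial z j.
Proof.
rewrite /monomial -prod_exp_degree -big_split/=; apply: eq_bigr => i _.
by rewrite exprMn.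
Qed.

Lemma horner_slice f N z t :
  (slice f N z).[t] = truncation f N (fun i => t * z i).
Proof.
rewrite /slice horner_poly /truncation big_simplex; apply: eq_bigr => m _.
rewrite /homog_part mulr_suml; apply: eq_big_seq => j.
by rewrite mem_homog monomialZ => /eqP <-; ring.
Qed.

Lemma homog_part0 f z : homog_part f 0 z = f [ffun => 0%N].
Proof.
rewrite /homog_part (perm_big [:: [ffun => 0%N]]).
  rewrite big_seq1 /monomial big1 ?mulr1// => i _.
  by rewrite ffunE expr0.
apply: uniq_perm; rewrite ?uniq_homog// => j; rewrite mem_homog inE.
apply/idP/eqP => [/eqP j0|->].
  apply/ffunP => i; rewrite ffunE.
  by have := index_le_degree j i; rewrite j0 leqn0 => /eqP.
by rewrite /total_degree big1// => i _; rewrite ffunE.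
Qed.

End Slices.

(** * Confinement of the coefficients of a zero-free series *)

Section NewtonStability.
Context {R : realType}.
Implicit Types (F G p q : nat -> R[i]).

(** Newton's identities freed from polynomials: once [F 0] is fixed and nonzero, [F 1, ..., F m] and
    [p 1, ..., p m] determine each other. *)
Definition newton F p :=
  forall k, F k *+ k = - \sum_(i < k) F i * p (k - i)%N.

Lemma newtonS F p k : newton F p ->
  F 0%N * p k.+1 = - (F k.+1 *+ k.+1) - \sum_(i < k) F i.+1 * p (k - i)%N.
Proof.
move=> /(_ k.+1); rewrite big_ord_recl/= subn0 => /(congr1 -%R).
by rewrite opprK => ->; rewrite addrK.
Qed.

Lemma ler_normc_sub_mul (a b c d : R[i]) (A C e e' : R) :
  normc a <= A -> normc d <= C -> normc (a - b) <= e -> normc (c - d) <= e' ->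
  normc (a * c - b * d) <= A * e' + e * C.
Proof.
move=> aA dC abe cde.
have -> : a * c - b * d = a * (c - d) + (a - b) * d by ring.
apply: (le_trans (ler_normcD _ _)); rewrite !normcM.
by apply: lerD; apply: ler_pM; rewrite ?normc_ge0.
Qed.

Lemma ler_normc_sum_const k (H : 'I_k -> R[i]) (B : R) :
  (forall i, normc (H i) <= B) -> normc (\sum_i H i) <= k%:R * B.
Proof.
move=> HB; apply: (le_trans (ler_normc_sum _ _ _)).
apply: (le_trans (ler_sum _ (fun i _ => HB i))).
by rewrite sumr_const card_ord mulr_natl.
Qed.

Lemma normc_mulrn (z : R[i]) k : normc (z *+ k) = k%:R * normc z.
Proof. by rewrite -[z *+ k]mulr_natl normcM normc_nat. Qed.

(** Solving for [p m] divides by [F 0], which stays away from zero; by induction the power sums are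
    bounded and Lipschitz in the coefficients. The size of [kappa] is irrelevant, since only the
    choice of a mesh depends on it. *)
Lemma newton_stability (b K : R) M : 0 < b -> 0 <= K ->
  exists2 kappa : R, 0 <= kappa &
    forall F G p q e m, newton F p -> newton G q ->
    0 <= e -> (0 < m <= M)%N -> b <= normc (F 0%N) -> b <= normc (G 0%N) ->
    (forall i, (i <= m)%N -> [/\ normc (F i) <= K, normc (G i) <= K &
       normc (F i - G i) <= e]) ->
    [/\ normc (p m) <= kappa, normc (q m) <= kappa &
        normc (p m - q m) <= kappa * e].
Proof.
move=> b0 K0; elim: M => [|M [kappa kappa0 IH]].
  by exists 0 => // F G p q e m _ _ _; case: m.
(* [A] bounds the power sums up to degree [M.+1], and [B] their Lipschitz constant as well. *)
pose A := kappa + (M.+1%:R * K + M%:R * (K * kappa)) / b.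
pose B := A + (A + M.+1%:R + M%:R * (K * kappa + kappa)) / b.
have kA : kappa <= A by rewrite lerDl divr_ge0 ?(ltW b0)// addr_ge0 ?mulr_ge0.
have A0 : 0 <= A by apply: le_trans kA.
have AB : A <= B.
  have h : 0 <= M%:R * (K * kappa + kappa) by rewrite mulr_ge0// addr_ge0// mulr_ge0.
  by rewrite lerDl divr_ge0 ?(ltW b0)// addr_ge0// addr_ge0.
exists B; first by apply: le_trans AB.
move=> F G p q e m nF nG e0 /andP[m0]; rewrite leq_eqVlt => /predU1P[mM|mM] bF bG FG.
  subst m; have IHk k : (k < M)%N -> [/\ normc (p (M - k)%N) <= kappa,
      normc (q (M - k)%N) <= kappa & normc (p (M - k)%N - q (M - k)%N) <= kappa * e].
    move=> kM; apply: (IH F G) => //; first by rewrite subn_gt0 kM leq_subr.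
    by move=> i ik; apply: FG; rewrite (leq_trans ik)// (leq_trans (leq_subr _ _)).
  have size_le H r : newton H r -> b <= normc (H 0%N) ->
      (forall i, (i <= M.+1)%N -> normc (H i) <= K) ->
      (forall k, (k < M)%N -> normc (r (M - k)%N) <= kappa) ->
      normc (r M.+1) <= A.
    move=> nH bH HK rk; rewrite /A -[leLHS]add0r lerD//.
    rewrite ler_pdivlMr// mulrC; apply: (@le_trans _ _ (normc (H 0%N) * normc (r M.+1))).
      by rewrite ler_wpM2r ?normc_ge0.
    rewrite -normcM (newtonS _ nH) -opprD normc_opp.
    apply: (le_trans (ler_normcD _ _)); rewrite normc_mulrn; apply: lerD.
      by rewrite ler_wpM2l// HK.
    apply: ler_normc_sum_const => i; rewrite normcM.
    by apply: ler_pM; rewrite ?normc_ge0 ?HK ?rk// ltnS ltnW.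
  have pA : normc (p M.+1) <= A.
    by apply: (size_le F) => // [i /FG[]//|k /IHk[]].
  have qA : normc (q M.+1) <= A.
    by apply: (size_le G) => // [i /FG[]//|k /IHk[]].
  split; [exact: le_trans pA AB|exact: le_trans qA AB|].
  (* Difference of the two solved identities; the first term accounts for [F 0] and [G 0] being
     different. *)
  have E : F 0%N * (p M.+1 - q M.+1) = - ((F 0%N - G 0%N) * q M.+1)
      - (F M.+1 - G M.+1) *+ M.+1
      - \sum_(i < M) (F i.+1 * p (M - i)%N - G i.+1 * q (M - i)%N).
    rewrite mulrBr (newtonS _ nF) mulrBl (newtonS _ nG) sumrB mulrnBl; ring.
  have : b * normc (p M.+1 - q M.+1) <=
      (A + M.+1%:R + M%:R * (K * kappa + kappa)) * e.
    apply: (@le_trans _ _ (normc (F 0%N) * normc (p M.+1 - q M.+1))).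
      by rewrite ler_wpM2r ?normc_ge0.
    rewrite -normcM E; apply: (le_trans (ler_normcB _ _)).
    rewrite [leRHS]mulrDl; apply: lerD.
      apply: (le_trans (ler_normcB _ _)).
      rewrite normc_opp normc_mulrn [leRHS]mulrDl; apply: lerD.
        rewrite normcM mulrC; have [_ _ h] := FG 0%N isT.
        by apply: ler_pM; rewrite ?normc_ge0.
      by have [_ _ h] := FG M.+1 (leqnn _); rewrite ler_wpM2l.
    rewrite -mulrA; apply: ler_normc_sum_const => i.
    have [a1 a2 a3] := FG i.+1 (leqW (ltn_ord i)).
    have [c1 c2 c3] := IHk i (ltn_ord i).
    apply: (le_trans (ler_normc_sub_mul a1 c2 a3 c3)).
    by rewrite le_eqVlt; apply/orP; left; apply/eqP; ring.
  move=> h; rewrite /B mulrDl -[leLHS]add0r; apply: lerD; first by rewrite mulr_ge0.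
  by rewrite mulrAC ler_pdivlMr// mulrC.
have [|h1 h2 h3] := IH F G p q e m nF nG e0 _ bF bG FG; first by rewrite m0.
split; [exact: le_trans h1 (le_trans kA AB)|exact: le_trans h2 (le_trans kA AB)|].
by apply: (le_trans h3); rewrite ler_wpM2r// (le_trans kA AB).
Qed.

(** Stability cannot control [p m.+1], which depends on the unknown [F m.+1]. The products
    [F 0 * p m.+1] and [G 0 * q m.+1] are therefore bounded separately, whence [2 * (u * L)];
    stability serves for the lower degrees only. *)
Lemma newton_gap (b K : R) M : 0 < b -> 0 <= K ->
  exists2 kappa : R, 0 <= kappa &
    forall F G p q e u L m, newton F p -> newton G q ->
    0 <= e -> (m < M)%N -> b <= normc (F 0%N) -> b <= normc (G 0%N) ->
    (forall i, (i <= m)%N -> [/\ normc (F i) <= K, normc (G i) <= K &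
       normc (F i - G i) <= e]) ->
    normc (F 0%N) <= u -> normc (G 0%N) <= u ->
    normc (p m.+1) <= L -> normc (q m.+1) <= L ->
    normc (F m.+1 - G m.+1) <= 2 * (u * L) + kappa * e.
Proof.
move=> b0 K0; have [k k0 kP] := newton_stability M b0 K0.
exists (M%:R * (K * k + k)); first by rewrite mulr_ge0 ?addr_ge0 ?mulr_ge0.
move=> F G p q e u L m nF nG e0 mM bF bG FG Fu Gu pL qL.
have E : (F m.+1 - G m.+1) *+ m.+1 = - (F 0%N * p m.+1 - G 0%N * q m.+1)
    - \sum_(i < m) (F i.+1 * p (m - i)%N - G i.+1 * q (m - i)%N).
  rewrite (newtonS _ nF) (newtonS _ nG) sumrB mulrnBl; ring.
apply: (@le_trans _ _ (normc ((F m.+1 - G m.+1) *+ m.+1))).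
  by rewrite normc_mulrn ler_peMl ?normc_ge0// ler1n.
rewrite E; apply: (le_trans (ler_normcB _ _)); apply: lerD.
  rewrite normc_opp mulr2n mulrDl mul1r; apply: (le_trans (ler_normcB _ _)).
  by rewrite !normcM; apply: lerD; apply: ler_pM; rewrite ?normc_ge0.
apply: (@le_trans _ _ (m%:R * ((K * k + k) * e))).
  apply: ler_normc_sum_const => i.
  have [a1 a2 a3] := FG i.+1 (ltn_ord i).
  have [||c1 c2 c3] := kP F G p q e (m - i)%N nF nG e0 _ bF bG _.
  - by rewrite subn_gt0 ltn_ord/= (leq_trans (leq_subr _ _))// ltnW.
  - by move=> l li; apply: FG; exact: leq_trans li (leq_subr _ _).
  apply: (le_trans (ler_normc_sub_mul a1 c2 a3 c3)).
  by rewrite le_eqVlt; apply/orP; left; apply/eqP; ring.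
rewrite -mulrA ler_wpM2r ?mulr_ge0 ?addr_ge0 ?mulr_ge0// ler_nat ltnW//.
Qed.

End NewtonStability.

Section CoefficientGap.
Context {R : realType} {n : nat}.
Implicit Types (f g : multi_index n -> R[i]) (z : 'I_n -> R[i]).

(** Stated for truncations because a polynomial slice has a finite list of inverse zeros. *)
Definition zero_free f (rho : R) := exists N0, forall N z, (N0 <= N)%N ->
  (forall i, normc (z i) <= rho) -> truncation f N z != 0.

(** The radius is the one at which [zero_count_le] counts the zeros in the disc of radius
    [2 ^+ q.+1 * rho]; the exponent scales like the square of that radius. *)
Definition order_two_growth f (rho D : R) := forall N z q,
  (forall i, normc (z i) <= 5 * (2 ^+ q.+1 * rho)) ->
  normc (truncation f N z) <= normc (f [ffun=> 0%N]) * expR (D * 4 ^+ q.+1).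

(** The bound does not involve the truncation, which can thus be taken so long that it is both
    zero-free and exact up to degree [M]. *)
Lemma slice_power_sums f (rho D : R) z : 0 < rho ->
  f [ffun=> 0%N] != 0 -> (forall i, normc (z i) = 1) ->
  zero_free f rho -> order_two_growth f rho D ->
  forall M, exists F p : nat -> R[i], [/\ newton F p,
    forall m, (m <= M)%N -> F m = homog_part f m z &
    forall m, (3 <= m)%N -> normc (p m) <= (8 * D + 1) / rho ^+ m].
Proof.
move=> rho0 f0 z1 [N0 fN0] grow M; pose N := maxn N0 M.
pose F := slice f N z.
have [N0N MN] : (N0 <= N)%N /\ (M <= N)%N by rewrite leq_maxl leq_maxr.
have F0 : F`_0 = f [ffun=> 0%N] by rewrite coef_slice// homog_part0.
have [t tr|xs [FE xs1]] := poly_zero_inverses rho0 (_ : forall t, _ -> F.[t] != 0).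
  rewrite horner_slice; apply: fN0 => // i.
  by rewrite normcM z1 mulr1.
exists (fun k => F`_k), (power_sum xs); split.
- move=> k; rewrite [in LHS]FE; under eq_bigr => i _ do rewrite FE.
  exact: newton_identity.
- by move=> m mM; rewrite coef_slice// (leq_trans mM).
move=> m m3; rewrite ler_pdivlMr ?exprn_gt0//.
apply: power_sum_le => // q; apply: zero_count_le.
  by rewrite mulr_gt0 ?exprn_gt0.
move=> t ts; have := grow N (fun i => t * z i) q _.
rewrite -horner_slice -/F [in F.[t]]FE hornerZ F0 normcM ler_pM2l ?normc_gt0//.
by apply => i; rewrite normcM z1 mulr1 ts.
Qed.

Lemma normc_homog_part_le f m M z (V : R) : (m <= M)%N ->
  (forall i, normc (z i) = 1) ->
  (forall j, total_degree j = m -> normc (f j) <= V) -> 0 <= V ->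
  normc (homog_part f m z) <= (size (simplex M : seq (multi_index n)))%:R * V.
Proof.
move=> mM z1 fV V0; apply: (@le_trans _ _ (\sum_(j <- homog m : seq (multi_index n)) V)).
  apply: (le_trans (ler_normc_sum _ _ _)).
  rewrite big_seq [leRHS]big_seq; apply: ler_sum => j; rewrite mem_homog => /eqP jm.
  rewrite normcM normc_prod big1 ?mulr1 ?fV// => i _.
  by rewrite normcX z1 expr1n.
rewrite big_const_seq count_predT iter_addr_0 -[leLHS]mulr_natl ler_wpM2r// ler_nat.
apply: uniq_leq_size; first exact: uniq_homog.
by move=> j; rewrite mem_homog mem_simplex => /eqP ->.
Qed.

(* The circle average in Cauchy's estimate is replaced by a point [z] of the torus
   where the difference of the two degree-[m] parts is at least [normc (f j - g j)];
   there it equals, up to an error controlled by [eta], the difference of the power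
   sums of the two slices. *)
Lemma coef_gap (b u V rho D tau : R) M : 0 < b -> 0 < rho -> 0 <= V ->
  0 < tau -> exists2 eta : R, 0 < eta & forall f g,
    (forall h, h = f \/ h = g -> [/\ zero_free h rho, order_two_growth h rho D,
      b <= normc (h [ffun=> 0%N]) <= u &
      forall j, (total_degree j <= M)%N -> normc (h j) <= V]) ->
    forall m, (3 <= m <= M)%N ->
    (forall j, (total_degree j < m)%N -> normc (f j - g j) <= eta) ->
    forall j, total_degree j = m ->
    normc (f j - g j) <= 2 * (u * ((8 * D + 1) / rho ^+ m)) + tau.
Proof.
move=> b0 rho0 V0 tau0; set S : R := (size (simplex M : seq (multi_index n)))%:R.
have S0 : 0 <= S by rewrite /S.
have SV0 : 0 <= S * V by rewrite mulr_ge0.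
have [kappa kappa0 gap] := newton_gap M b0 SV0.
have den0 : 0 < kappa * S + 1 by rewrite ltr_wpDl// mulr_ge0.
(* The homogeneous parts then differ by at most [S * eta], and [kappa * (S * eta) <= tau]. *)
exists (tau / (kappa * S + 1)); first by rewrite divr_gt0.
move=> f g adm [//|m] /andP[m3 mM] close j jm.
have jh : j \in homog m.+1 by rewrite mem_homog jm.
have [z z1 fgj] := monomial_coef_le (fun k => f k - g k) (uniq_homog m.+1) jh.
apply: (le_trans fgj).
have -> : \sum_(k <- homog m.+1) (f k - g k) * monomial z k =
    homog_part f m.+1 z - homog_part g m.+1 z.
  by rewrite /homog_part -sumrB; apply: eq_bigr => k _; rewrite mulrBl.
have [fz fgr /andP[fb fu] fV] := adm f (or_introl erefl).
have [gz ggr /andP[gb gu] gV] := adm g (or_intror erefl).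
have nz (h : multi_index n -> R[i]) : b <= normc (h [ffun=> 0%N]) -> h [ffun=> 0%N] != 0.
  by move=> bh; rewrite -normc_gt0 (lt_le_trans b0).
have [F [p [np FE pm]]] := slice_power_sums rho0 (nz f fb) z1 fz fgr M.
have [G [q [nq GE qm]]] := slice_power_sums rho0 (nz g gb) z1 gz ggr M.
have e0 : 0 <= S * (tau / (kappa * S + 1)) by rewrite mulr_ge0// ltW// divr_gt0.
rewrite -!FE// -!GE//.
apply: (le_trans (gap F G p q _ u ((8 * D + 1) / rho ^+ m.+1) m np nq e0 mM
  _ _ _ _ _ (pm _ m3) (qm _ m3))); rewrite ?FE ?GE ?homog_part0//.
  move=> i im; have iM : (i <= M)%N by apply: leq_trans (ltnW mM).
  rewrite FE// GE//; split.
  - by apply: normc_homog_part_le => // k ki; apply: fV; rewrite ki.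
  - by apply: normc_homog_part_le => // k ki; apply: gV; rewrite ki.
  rewrite /homog_part -sumrB.
  have -> : \sum_(k <- homog i) (f k * monomial z k - g k * monomial z k) =
      homog_part (fun k => f k - g k) i z.
    by rewrite /homog_part; apply: eq_bigr => k _; rewrite mulrBl.
  apply: normc_homog_part_le => // [k ki|]; last by rewrite ltW// divr_gt0.
  by apply: close; rewrite ki ltnS.
rewrite lerD2l !mulrA ler_pdivrMr// mulrC ler_wpM2l ?(ltW tau0)//.
by rewrite lerDl.
Qed.

End CoefficientGap.

(** * Unordered sums and power series on polydiscs *)

#[local] Existing Instance totally_filter.

Section UnorderedSums.
Context {R : realType} {I : choiceType}.
Implicit Types (a : I -> R[i]) (s : seq I).

Definition abs_bounded a := exists B : R,
  forall s, uniq s -> \sum_(j <- s) normc (a j) <= B.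

Definition has_unordered_sum a (L : R[i]) := forall e : R, 0 < e ->
  exists s0, forall s, uniq s -> {subset s0 <= s} ->
  normc (L - \sum_(j <- s) a j) <= e.

Lemma fset_of_seq s : exists J : {fset I}, forall j, (j \in J) = (j \in s).
Proof. by exists [fset j in s]%fset => j; rewrite inE. Qed.

Lemma partial_sumE a (J : {fset I}) : partial_sum a J = \sum_(j <- J) a j.
Proof. by rewrite big_seq_fsetE. Qed.

Lemma unordered_sumP a L :
  has_unordered_sum a L <-> partial_sum (a : I -> R[i]^o) @ totally --> (L : R[i]^o).
Proof.
split=> [aL|/cvgrPdist_le aL].
  apply/cvgrPdist_le => e e0.
  (* In the order of [R[i]] a positive element is a positive real. *)
  have /andP[/eqP Ie Re0] : (complex.Im e == 0) && (0 < complex.Re e).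
    by move: e0; rewrite ltcE/= eq_sym.
  have eE : e = (complex.Re e)%:C by move: Ie; case: (e) => x y /= ->.
  have [s0 s0P] := aL _ Re0; have [J JP] := fset_of_seq s0.
  exists J => // K /= JK; rewrite eE normrC lecR partial_sumE.
  by apply: s0P => // j; rewrite -JP; exact: (fsubsetP JK).
move=> e e0; have [|J _ JP] := aL e%:C; first by rewrite ltcR.
exists J => s us sJ; have [K KP] := fset_of_seq s.
have := JP K; rewrite /= normrC lecR partial_sumE.
rewrite (perm_big s).
  by apply; apply/fsubsetP => j jJ; rewrite KP sJ.
by apply: uniq_perm.
Qed.

Lemma unordered_sumE a L : has_unordered_sum a L -> sum (a : I -> R[i]^o) = L.
Proof.
by move=> /unordered_sumP aL; apply: cvg_lim => //; exact: norm_hausdorff.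
Qed.

Lemma ge0_unordered_limit (r : I -> R) (B : R) : (forall j, 0 <= r j) ->
  (forall s, uniq s -> \sum_(j <- s) r j <= B) ->
  exists L, forall e, 0 < e -> exists s0, forall s, uniq s ->
    {subset s0 <= s} -> `|L - \sum_(j <- s) r j| <= e.
Proof.
move=> r0 rB; pose A := [set \sum_(j <- s) r j | s in [set s | uniq s]].
have supA : has_sup A.
  split; first by exists 0, [::] => //; rewrite big_nil.
  by exists B => _ [s us <-]; exact: rB.
exists (sup A) => e e0; have [_ [s0 us0 <-] s0P] := sup_adherent e0 supA.
exists s0 => s us s0s; rewrite ger0_norm ?subr_ge0.
  rewrite lerBlDl -lerBlDr; apply: (le_trans (ltW s0P)).
  exact: ler_sum_sub.
by apply: sup_upper_bound => //; exists s.
Qed.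

(** Each real component [r] is the difference of the nonnegative families [|r| + r] and [|r|], whose
    unordered sums are suprema. *)
Lemma abs_bounded_sum a : abs_bounded a -> exists L, has_unordered_sum a L.
Proof.
move=> [B aB].
have real_limit (r : I -> R) : (forall j, `|r j| <= normc (a j)) ->
    exists L, forall e, 0 < e -> exists s0, forall s, uniq s ->
    {subset s0 <= s} -> `|L - \sum_(j <- s) r j| <= e.
  move=> ra.
  have [||L1 L1P] := @ge0_unordered_limit (fun j => `|r j| + r j) (2 * B).
  - by move=> j; have := ler_norm (- r j); rewrite normrN; lra.
  - move=> s us; rewrite mulrC -ler_pdivrMr// mulr_suml; apply: le_trans (aB s us).
    apply: ler_sum => j _; rewrite ler_pdivrMr// mulr_natr mulr2n.
    by apply: lerD => //; apply: le_trans (ra j); exact: ler_norm.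
  have [||L2 L2P] := @ge0_unordered_limit (fun j => `|r j|) B.
  - by [].
  - by move=> s us; apply: le_trans (aB s us); apply: ler_sum.
  exists (L1 - L2) => e e0; have e20 : 0 < e / 2 by rewrite divr_gt0.
  have [s1 s1P] := L1P _ e20; have [s2 s2P] := L2P _ e20.
  exists (s1 ++ s2) => s us ss.
  have {}s1P : `|L1 - \sum_(j <- s) (`|r j| + r j)| <= e / 2.
    by apply: s1P => // j js; apply: ss; rewrite mem_cat js.
  have {}s2P : `|L2 - \sum_(j <- s) `|r j| | <= e / 2.
    by apply: s2P => // j js; apply: ss; rewrite mem_cat js orbT.
  rewrite big_split/= in s1P.
  set x := \sum_(j <- s) `|r j| in s1P s2P; set y := \sum_(j <- s) r j in s1P *.
  have -> : L1 - L2 - y = (L1 - (x + y)) - (L2 - x) by ring.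
  by apply: (le_trans (ler_normB _ _)); lra.
have [L1 L1P] := real_limit _ (fun j => normRe_le (a j)).
have [L2 L2P] := real_limit _ (fun j => normIm_le (a j)).
exists (L1 +i* L2) => e e0; have e20 : 0 < e / 2 by rewrite divr_gt0.
have [s1 s1P] := L1P _ e20; have [s2 s2P] := L2P _ e20.
exists (s1 ++ s2) => s us ss.
have {}s1P : `|L1 - \sum_(j <- s) complex.Re (a j)| <= e / 2.
  by apply: s1P => // j js; apply: ss; rewrite mem_cat js.
have {}s2P : `|L2 - \sum_(j <- s) complex.Im (a j)| <= e / 2.
  by apply: s2P => // j js; apply: ss; rewrite mem_cat js orbT.
apply: (le_trans (normc_leD _)).
have -> : \sum_(j <- s) a j = (\sum_(j <- s) complex.Re (a j)) +i*
    (\sum_(j <- s) complex.Im (a j)).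
  elim: (s) => [|j t IH]; first by rewrite !big_nil.
  by rewrite !big_cons IH; case: (a j).
by rewrite /=; lra.
Qed.

Lemma sum_abs_bounded a : abs_bounded a ->
  has_unordered_sum a (sum (a : I -> R[i]^o)).
Proof. by move=> /abs_bounded_sum[L aL]; rewrite (unordered_sumE aL). Qed.

(** Finite sums avoiding [s0] have modulus at most [2]. Restricting them to indices where the real
    (or imaginary) part has one sign excludes cancellation and so bounds the sums of absolute
    values. *)
Lemma unordered_sum_abs_bounded a L : has_unordered_sum a L -> abs_bounded a.
Proof.
move=> /(_ 1 ltr01)[s1 s1P]; pose s0 := undup s1.
have tail s : uniq s -> {in s, forall j, j \notin s0} ->
    normc (\sum_(j <- s) a j) <= 2.
  move=> us ss0.
  have : normc (L - \sum_(j <- s0) a j) <= 1.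
    by apply: s1P; rewrite ?undup_uniq// => j; rewrite mem_undup.
  have : normc (L - \sum_(j <- s0 ++ s) a j) <= 1.
    apply: s1P; last by move=> j; rewrite mem_cat mem_undup => ->.
    by rewrite cat_uniq undup_uniq us andbT/=; apply/hasPn => j /ss0.
  rewrite big_cat/= => h1 h2.
  have -> : \sum_(j <- s) a j = (L - \sum_(j <- s0) a j) -
    (L - (\sum_(j <- s0) a j + \sum_(j <- s) a j)) by ring.
  by apply: (le_trans (ler_normcB _ _)); lra.
have real_tail (h : R[i] -> R) s : {morph h : x y / x + y} -> h 0 = 0 ->
    (forall x, `|h x| <= normc x) ->
    uniq s -> {in s, forall j, j \notin s0} ->
    \sum_(j <- s) `|h (a j)| <= 4.
  move=> hD h0 hle us ss0; rewrite (bigID (fun j => 0 <= h (a j)))/=.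
  have part (P : pred I) : `|\sum_(j <- s | P j) h (a j)| <= 2.
    rewrite -big_filter -(big_morph h hD h0).
    apply: (le_trans (hle _)); apply: tail; first by rewrite filter_uniq.
    by move=> j; rewrite mem_filter => /andP[_ /ss0].
  rewrite (eq_bigr (fun j => h (a j))) => [|j hj]; last by rewrite ger0_norm.
  rewrite [X in _ + X](eq_bigr (fun j => - h (a j))) => [|j]; last first.
    by rewrite -ltNge => hj; rewrite ltr0_norm.
  rewrite sumrN; have := part (fun j => 0 <= h (a j)).
  have := part (fun j => ~~ (0 <= h (a j))).
  by rewrite !ler_norml; lra.
exists (\sum_(j <- s0) normc (a j) + 8) => s us.
rewrite (bigID (fun j => j \in s0))/=; apply: lerD.
  rewrite -big_filter; apply: ler_sum_sub; rewrite ?filter_uniq//.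
    by move=> j; rewrite mem_filter => /andP[].
  by move=> j; exact: normc_ge0.
rewrite -big_filter; set t := [seq _ <- _ | _].
have ut : uniq t by rewrite filter_uniq.
have ts0 : {in t, forall j, j \notin s0}.
  by move=> j; rewrite mem_filter => /andP[].
have h1 : \sum_(j <- t) `|complex.Re (a j)| <= 4.
  by apply: real_tail => //; [case=> ? ? [? ?]|exact: normRe_le].
have h2 : \sum_(j <- t) `|complex.Im (a j)| <= 4.
  by apply: real_tail => //; [case=> ? ? [? ?]|exact: normIm_le].
apply: (@le_trans _ _ (\sum_(j <- t) (`|complex.Re (a j)| + `|complex.Im (a j)|))).
  by apply: ler_sum => j _; exact: normc_leD.
by rewrite big_split/=; lra.
Qed.

(* A sum that does not converge takes the default value [0]. *)
Lemma sum_neq0_abs_bounded a : sum (a : I -> R[i]^o) != 0 -> abs_bounded a.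
Proof.
move=> a0; have [cv|/dvgP] := pselect (cvg (partial_sum (a : I -> R[i]^o) @ totally)).
  exact: (unordered_sum_abs_bounded ((unordered_sumP _ _).2 cv)).
by rewrite -/(sum _) => E; move: a0; rewrite E eqxx.
Qed.

Lemma normc_sum_sub_le a s (T : R) : abs_bounded a -> uniq s ->
  (forall t, uniq t -> {in t, forall j, j \notin s} ->
    \sum_(j <- t) normc (a j) <= T) ->
  normc (sum (a : I -> R[i]^o) - \sum_(j <- s) a j) <= T.
Proof.
move=> /sum_abs_bounded aL us tT; apply/ler_addgt0Pr => e e0.
have [s0 s0P] := aL e e0; pose t := [seq j <- undup s0 | j \notin s].
have ut : uniq t by rewrite filter_uniq ?undup_uniq.
have ts : {in t, forall j, j \notin s} by move=> j; rewrite mem_filter => /andP[].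
have := s0P (s ++ t) _ _; rewrite big_cat/= => h.
set L := sum _ in h *.
have -> : L - \sum_(j <- s) a j =
  \sum_(j <- t) a j + (L - (\sum_(j <- s) a j + \sum_(j <- t) a j)) by ring.
apply: (le_trans (ler_normcD _ _)); apply: lerD.
  exact: le_trans (ler_normc_sum _ _ _) (tT t ut ts).
apply: h; first by rewrite cat_uniq us ut andbT/=; apply/hasPn => j /ts.
move=> j js0; rewrite mem_cat mem_filter mem_undup js0 andbT.
by case: (j \in s).
Qed.

End UnorderedSums.

Section CoordinatewiseClosure.
Context {R : realType} {T : Type}.
Variable Q : (T -> R) -> Prop.
Hypothesis Q_cst : forall c, Q (fun=> c).
Hypothesis Q_add : forall f g, Q f -> Q g -> Q (fun x => f x + g x).
Hypothesis Q_mul : forall f g, Q f -> Q g -> Q (fun x => f x * g x).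

(** [Q] is to be continuity in the point and measurability in the outcome; truncations are treated
    once for both. *)
Definition coordinatewise (h : T -> R[i]) :=
  Q (fun x => complex.Re (h x)) /\ Q (fun x => complex.Im (h x)).

Lemma coordinatewise_cst c : coordinatewise (fun=> c).
Proof. by split; exact: Q_cst. Qed.

Lemma coordinatewise_add h k : coordinatewise h -> coordinatewise k ->
  coordinatewise (fun x => h x + k x).
Proof.
move=> [h1 h2] [k1 k2]; split.
  rewrite (_ : (fun x => _) = (fun x => complex.Re (h x) + complex.Re (k x))).
    exact: Q_add.
  by apply/funext => x; case: (h x) (k x) => ? ? [].
rewrite (_ : (fun x => _) = (fun x => complex.Im (h x) + complex.Im (k x))).
  exact: Q_add.
by apply/funext => x; case: (h x) (k x) => ? ? [].
Qed.

Lemma coordinatewise_mul h k : coordinatewise h -> coordinatewise k ->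
  coordinatewise (fun x => h x * k x).
Proof.
move=> [h1 h2] [k1 k2]; split.
  rewrite (_ : (fun x => _) = (fun x => complex.Re (h x) * complex.Re (k x)
      + (-1) * (complex.Im (h x) * complex.Im (k x)))).
    by apply: Q_add; [|apply: Q_mul]; rewrite ?[Q (fun=> _)]Q_cst; try exact: Q_mul.
  by apply/funext => x; case: (h x) (k x) => ? ? [? ?]/=; ring.
rewrite (_ : (fun x => _) = (fun x => complex.Re (h x) * complex.Im (k x)
      + complex.Im (h x) * complex.Re (k x))).
  by apply: Q_add; exact: Q_mul.
by apply/funext => x; case: (h x) (k x) => ? ? [? ?].
Qed.

Lemma coordinatewise_sum (I : Type) (r : seq I) (F : I -> T -> R[i]) :
  (forall i, coordinatewise (F i)) ->
  coordinatewise (fun x => \sum_(i <- r) F i x).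
Proof.
move=> FQ; elim: r => [|i r IH].
  by under eq_fun do rewrite big_nil; exact: coordinatewise_cst.
by under eq_fun do rewrite big_cons; exact: coordinatewise_add.
Qed.

Lemma coordinatewise_prod (I : Type) (r : seq I) (F : I -> T -> R[i]) :
  (forall i, coordinatewise (F i)) ->
  coordinatewise (fun x => \prod_(i <- r) F i x).
Proof.
move=> FQ; elim: r => [|i r IH].
  by under eq_fun do rewrite big_nil; exact: coordinatewise_cst.
by under eq_fun do rewrite big_cons; exact: coordinatewise_mul.
Qed.

Lemma coordinatewise_exp h k : coordinatewise h ->
  coordinatewise (fun x => h x ^+ k).
Proof.
move=> hQ; elim: k => [|k IH].
  by under eq_fun do rewrite expr0; exact: coordinatewise_cst.
by under eq_fun do rewrite exprS; exact: coordinatewise_mul.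
Qed.

Lemma coordinatewise_truncation n (f : multi_index n -> T -> R[i]) N
    (z : 'I_n -> T -> R[i]) :
  (forall j, coordinatewise (f j)) -> (forall i, coordinatewise (z i)) ->
  coordinatewise (fun x => truncation (f^~ x) N (z^~ x)).
Proof.
move=> fQ zQ; apply: coordinatewise_sum => j; apply: coordinatewise_mul => //.
by apply: coordinatewise_prod => i; exact: coordinatewise_exp.
Qed.

Lemma coordinatewise_normc2 h : coordinatewise h -> Q (fun x => normc (h x) ^+ 2).
Proof.
move=> [h1 h2]; rewrite (_ : (fun x => _) = (fun x =>
  complex.Re (h x) * complex.Re (h x) + complex.Im (h x) * complex.Im (h x))).
  by apply: Q_add; exact: Q_mul.
by apply/funext => x; rewrite normc_sqr !expr2.
Qed.

End CoordinatewiseClosure.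

(** * Power series on closed polydiscs *)

Section PowerSeries.
Context {R : realType} {n : nat}.
Implicit Types (f : multi_index n -> R[i]) (z : 'I_n -> R[i]) (q : 'I_n -> R).

Definition power_series f z : R[i] := sum (fun j => f j * monomial z j : R[i]^o).

Definition polydisc q := [set z | forall i, normc (z i) <= q i].

(** Absolute convergence at the corner [q], whose terms dominate those at every point of the
    polydisc. *)
Definition converges_on f q := exists B : R, forall s, uniq s ->
  \sum_(j <- s) normc (f j) * monomial q j <= B.

Lemma normc_monomial_mono z q j : polydisc q z -> normc (monomial z j) <= monomial q j.
Proof.
move=> zq; rewrite normc_prod; apply: ler_prod => i _.
by rewrite normc_ge0 normcX lerXn2r ?nnegrE ?normc_ge0// (le_trans (normc_ge0 _) (zq i)).
Qed.

Lemma converges_on_abs_bounded f q z : converges_on f q -> polydisc q z ->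
  abs_bounded (fun j => f j * monomial z j).
Proof.
move=> [B fB] zq; exists B => s us; apply: le_trans (fB s us).
by apply: ler_sum => j _; rewrite normcM ler_wpM2l ?normc_ge0 ?normc_monomial_mono.
Qed.

Lemma truncation_unif_cvg f q (e : R) : converges_on f q ->
  (forall i, 0 <= q i) -> 0 < e ->
  exists N0, forall N z, (N0 <= N)%N -> polydisc q z ->
  normc (power_series f z - truncation f N z) <= e.
Proof.
move=> fq q0 e0; pose r j := normc (f j) * monomial q j.
have r0 j : 0 <= r j.
  rewrite mulr_ge0 ?normc_ge0//; apply: prodr_ge0 => i _; exact: exprn_ge0.
have [B fB] := fq.
have [L LP] := ge0_unordered_limit r0 fB.
have [s0 s0P] := LP (e / 2) (divr_gt0 e0 (ltr0n _ 2)).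
have [N0 s0N] := sub_simplex s0.
exists N0 => N z N0N zq; apply: normc_sum_sub_le.
- exact: converges_on_abs_bounded fq zq.
- exact: uniq_simplex.
move=> t ut tN; apply: (@le_trans _ _ (\sum_(j <- t) r j)).
  by apply: ler_sum => j _; rewrite normcM ler_wpM2l ?normc_ge0 ?normc_monomial_mono.
have sub : {subset s0 <= simplex N}.
  by move=> j /s0N; rewrite !mem_simplex => jN; exact: leq_trans jN N0N.
have h1 := s0P _ (uniq_simplex N) sub.
have h2 : `|L - \sum_(j <- simplex N ++ t) r j| <= e / 2.
  apply: s0P => [|j /sub js]; last by rewrite mem_cat js.
  by rewrite cat_uniq uniq_simplex ut andbT/=; apply/hasPn => j /tN.
rewrite big_cat/= in h2; move: h1 h2; rewrite !ler_norml.
by lra.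
Qed.

Definition complex_coords (x : 'rV[R]_(n + n)) (i : 'I_n) : R[i] :=
  x 0 (lshift n i) +i* x 0 (rshift n i).

Lemma complex_coords_surj z : exists x, complex_coords x = z.
Proof.
exists (\row_(k < n + n) match fintype.split k with
  inl i => complex.Re (z i) | inr i => complex.Im (z i) end).
apply/funext => i; rewrite /complex_coords !mxE.
rewrite -[lshift n i]/(unsplit (inl i)) -[rshift n i]/(unsplit (inr i)) !unsplitK.
by case: (z i).
Qed.

Lemma continuous_truncation f N :
  continuous (fun x => normc (truncation f N (complex_coords x))).
Proof.
have cont : continuous (fun x => normc (truncation f N (complex_coords x)) ^+ 2).
  apply: (@coordinatewise_normc2 R _ (fun h => continuous h)).
  - by move=> h k ch ck x; apply: continuousD; [exact: ch|exact: ck].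
  - by move=> h k ch ck x; apply: continuousM; [exact: ch|exact: ck].
  apply: (@coordinatewise_truncation R _ _ _ _ _ n (fun j _ => f j) N
    (fun i x => complex_coords x i)).
  - by move=> c; exact: cst_continuous.
  - by move=> h k ch ck x; apply: continuousD; [exact: ch|exact: ck].
  - by move=> h k ch ck x; apply: continuousM; [exact: ch|exact: ck].
  - by move=> j; split; exact: cst_continuous.
  - by move=> i; split => x; exact: coord_continuous.
rewrite (_ : (fun x => _) = Num.sqrt \o
    (fun x => normc (truncation f N (complex_coords x)) ^+ 2)).
  by move=> x; apply: continuous_comp; [exact: cont|exact: sqrt_continuous].
by apply/funext => x /=; rewrite sqrtr_sqr ger0_norm ?normc_ge0.
Qed.

Definition real_polydisc q := [set x | polydisc q (complex_coords x)].

Lemma compact_real_polydisc q : compact (real_polydisc q).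
Proof.
pose B (k : 'I_(n + n)) : R := match fintype.split k with inl i => q i | inr i => q i end.
pose A k : set R := `[- B k, B k]%classic.
apply: (@subclosed_compact _ _ [set x : 'rV[R]_(n + n) | forall k, A k (x ord0 k)]).
(* The squared modulus is a polynomial in the real coordinates; since [q i] may be negative,
   [0 <= q i] has to be recorded when squaring. *)
- rewrite (_ : real_polydisc q = \bigcap_(i in setT)
      [set x | normc (complex_coords x i) ^+ 2 <= q i ^+ 2 /\ 0 <= q i]).
    apply: closed_bigI => i _.
    have [qi0|qi0] := leP 0 (q i); last first.
      rewrite (_ : mkset _ = set0); first exact: closed0.
      by apply/seteqP; split => x //= [_]; lra.
    rewrite (_ : mkset _ = (fun x => normc (complex_coords x i) ^+ 2) @^-1`
        [set y | y <= q i ^+ 2]); last by apply/seteqP; split => x /= [].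
    apply: preimage_closed; last exact: closed_le.
    suff cont : continuous (fun x => normc (complex_coords x i) ^+ 2).
      by move=> x _; exact: cont.
    apply: (@coordinatewise_normc2 R _ (fun h => continuous h)).
    - by move=> h k ch ck x; apply: continuousD; [exact: ch|exact: ck].
    - by move=> h k ch ck x; apply: continuousM; [exact: ch|exact: ck].
    - by split => x; exact: coord_continuous.
  apply/seteqP; split => x /= xq i; have := xq i.
    move=> h _; have q0 := le_trans (normc_ge0 _) h.
    by split => //=; rewrite lerXn2r ?nnegrE ?normc_ge0.
  by move=> /(_ I)[h q0]; rewrite -ler_sqr ?nnegrE ?normc_ge0.
- by apply: rV_compact => k; exact: segment_compact.
move=> x xq k; rewrite /A /B /= in_itv/= -ler_norml.
rewrite -[k]splitK; case: (fintype.split k) => i; rewrite unsplitK /=; apply: le_trans (xq i).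
  exact: (normRe_le (complex_coords x i)).
exact: (normIm_le (complex_coords x i)).
Qed.

Lemma continuous_power_series f q : converges_on f q -> (forall i, 0 <= q i) ->
  {within real_polydisc q,
    continuous (fun x => normc (power_series f (complex_coords x)))}.
Proof.
move=> fq q0; apply/subspace_continuousP => x xq.
apply/cvgrPdist_le => e e0; have e40 : 0 < e / 4 by rewrite divr_gt0.
have [N NP] := truncation_unif_cvg fq q0 e40.
have /cvgrPdist_le/(_ _ e40) near_x := @continuous_truncation f N x.
rewrite near_withinE; near=> y => yq.
have xy : `|normc (truncation f N (complex_coords x)) -
  normc (truncation f N (complex_coords y))| <= e / 4 by near: y.
have Px := le_trans (ler_dist_normc _ _) (NP N _ (leqnn _) xq).
have Py := le_trans (ler_dist_normc _ _) (NP N _ (leqnn _) yq).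
rewrite [leRHS](_ : e = e / 4 + (e / 4 + e / 4) + e / 4); last by field.
apply: le_trans (ler_distD (normc (truncation f N (complex_coords y))) _ _) _.
apply: lerD; last by rewrite distrC.
apply: le_trans (ler_distD (normc (truncation f N (complex_coords x))) _ _) _.
exact: lerD Px (le_trans xy (ler_wpDl (ltW e40) (lexx _))).
Unshelve. all: by end_near.
Qed.

Lemma power_series_min f q : converges_on f q -> (forall i, 0 <= q i) ->
  (forall z, polydisc q z -> power_series f z != 0) ->
  exists2 e : R, 0 < e & forall z, polydisc q z -> e <= normc (power_series f z).
Proof.
move=> fq q0 fneq0.
have K0 : real_polydisc q !=set0.
  have [x xE] := complex_coords_surj (fun=> 0); exists x => i.
  by rewrite xE normc0_eq.
have [c cK cP] := EVT_min_rV K0 (@compact_real_polydisc q) (continuous_power_series fq q0).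
exists (normc (power_series f (complex_coords c))).
  by rewrite normc_gt0; apply: fneq0; rewrite inE in cK.
move=> z zq; have [x xE] := complex_coords_surj z.
by rewrite -xE; apply: cP; rewrite inE /real_polydisc/= xE.
Qed.

Lemma power_series_zero_free f (rho : R) : 0 <= rho ->
  converges_on f (fun=> rho) ->
  (forall z, polydisc (fun=> rho) z -> power_series f z != 0) ->
  exists N0, forall N z, (N0 <= N)%N -> (forall i, normc (z i) <= rho) ->
    truncation f N z != 0.
Proof.
move=> rho0 fq fneq0; have [e e0 eP] := power_series_min fq (fun=> rho0) fneq0.
have [N0 N0P] := truncation_unif_cvg fq (fun=> rho0) (divr_gt0 e0 (ltr0n _ 2)).
exists N0 => N z N0N zr; have := N0P N z N0N zr; have := eP z zr.
move=> ez ze; apply/eqP => E; rewrite E subr0 in ze.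
by move: (le_trans ez ze); rewrite leNgt => /negP; apply; lra.
Qed.

Definition rational_point (w : 'rV[rat]_(n + n)) : 'I_n -> R[i] :=
  complex_coords (map_mx ratr w).

(** A uniform lower bound, unlike mere nonvanishing, passes from rational points to their limits.
    The strict inequality leaves room for rational approximations of [z] inside the polydisc. *)
Lemma power_series_neq0_dense f q (e : R) : converges_on f q -> 0 < e ->
  (forall w, polydisc q (rational_point w) ->
     e <= normc (power_series f (rational_point w))) ->
  forall z, (forall i, normc (z i) < q i) -> power_series f z != 0.
Proof.
move=> fq e0 ef z zq; have [x xz] := complex_coords_surj z.
have q0 i : 0 <= q i by apply: ltW; apply: le_lt_trans (normc_ge0 _) (zq i).
have xq : real_polydisc q x by move=> i; rewrite xz; exact: ltW.
have /subspace_continuousP/(_ x xq)/cvgrPdist_lt/(_ e e0) := continuous_power_series fq q0.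
rewrite /within/= => /nbhs_ballP[d /= d0 dP].
(* Moving the real and the imaginary part by less than [d'] each moves [z i] by less than
   [2 * d']. *)
have [d' d'0 d'q] : exists2 d' : R, 0 < d' & forall i, normc (z i) + 2 * d' <= q i.
  exists (\big[Order.min/1]_i ((q i - normc (z i)) / 2)).
    by apply/bigmin_gtP; split => // i _; rewrite divr_gt0 ?subr_gt0.
  move=> i; rewrite -lerBrDl -ler_pdivlMl// mulrC.
  exact: bigmin_le_cond.
pose c := Num.min d d'; have c0 : 0 < c by rewrite lt_min d0.
have rat_near (a : R) : exists r : rat, `|a - ratr r| < c.
  have [|r] := @rat_in_itvoo _ (a - c) (a + c); first lra.
  by rewrite in_itv/= => /andP[h1 h2]; exists r; rewrite ltr_norml; lra.
pose w : 'rV[rat]_(n + n) := \row_(k < n + n) projT1 (cid (rat_near (x 0 k))).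
have wx k : `|x 0 k - ratr (w 0 k)| < c by rewrite mxE; case: cid.
pose y : 'rV[R]_(n + n) := map_mx ratr w.
have yq : real_polydisc q y.
  move=> i; have := d'q i.
  have -> : complex_coords y i = z i - (complex_coords x i - complex_coords y i).
    by rewrite xz; ring.
  move=> h; apply: (le_trans (ler_normcB _ _)); apply: le_trans h; rewrite lerD2l.
  apply: (le_trans (normc_leD _)) => /=.
  have := wx (lshift n i); have := wx (rshift n i); rewrite /y /= !mxE.
  have : c <= d' by rewrite ge_min lexx orbT.
  set u := `|_|; set v := `|_| => h1 h2 h3.
  by lra.
have xy : ball x d y.
  split=> // i k; rewrite ord1; apply: (@lt_le_trans _ _ c); last by rewrite ge_min lexx.
  by rewrite [y _ _]mxE; exact: wx.
apply/eqP => E; have := dP y xy yq.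
rewrite /from_subspace /= xz E normc0_eq sub0r normrN ger0_norm ?normc_ge0// => h.
by have := lt_le_trans h (ef w yq); rewrite ltxx.
Qed.

End PowerSeries.

(** * Gaussian estimates and grid cells *)

Section GaussianEstimates.
Context {R : realType}.

Local Notation lebesgue2 :=
  ((@lebesgue_measure R \x @lebesgue_measure R)%E).

Definition square (a b s : R) : set (measurableTypeR R * measurableTypeR R) :=
  `[a, a + s[%classic `*` `[b, b + s[%classic.

Lemma measurable_square a b s : measurable (square a b s).
Proof. by apply: measurableX; exact: measurable_itv. Qed.

Lemma lebesgue_square a b s : 0 < s -> lebesgue2 (square a b s) = (s ^+ 2)%:E.
Proof.
move=> s0; rewrite /square product_measure1E; [|exact: measurable_itv..].
rewrite /= !lebesgue_measure_itv/= !lte_fin !ltrDl s0 -!EFinB.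
by rewrite ![_ + s]addrC !addrK -EFinM expr2.
Qed.

Definition gaussian_density (x : measurableTypeR R * measurableTypeR R) : R :=
  pi^-1 * expR (- (x.1 ^+ 2 + x.2 ^+ 2)).

Lemma measurable_radius :
  measurable_fun setT (fun x : measurableTypeR R * measurableTypeR R => x.1 ^+ 2 + x.2 ^+ 2).
Proof. by apply: measurable_funD; apply: measurable_funX. Qed.

Lemma measurable_gaussian_density : measurable_fun setT gaussian_density.
Proof.
apply: measurable_funM => //; apply: measurableT_comp => //.
by apply: measurableT_comp => //; exact: measurable_radius.
Qed.

Lemma gaussian_density_ge0 x : 0 <= gaussian_density x.
Proof. by rewrite mulr_ge0 ?invr_ge0 ?pi_ge0 ?expR_ge0. Qed.

Lemma gaussian_density_le1 x : gaussian_density x <= 1.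
Proof.
rewrite -[leRHS]mulr1; apply: ler_pM; rewrite ?invr_ge0 ?pi_ge0 ?expR_ge0//.
  by rewrite invf_le1 ?pi_gt0// (le_trans _ (pi_ge2 R))// ler1n.
by rewrite -expR0 ler_expR oppr_le0 addr_ge0 ?sqr_ge0.
Qed.

(** The integrand is twice the product of two standard normal densities. *)
Lemma integral_exp_half : (\int[lebesgue2]_x
  (pi^-1 * expR (- (x.1 ^+ 2 + x.2 ^+ 2) / 2))%:E = 2%:E)%E.
Proof.
pose phi := normal_pdf (0 : R) 1.
have phi0 x : 0 <= phi x by exact: normal_pdf_ge0.
have mphi : measurable_fun setT phi by exact: measurable_normal_pdf.
have intphi : (\int[lebesgue_measure]_x (phi x)%:E = 1)%E by exact: integral_normal_pdf.
transitivity (\int[lebesgue2]_x (2 * (phi x.1 * phi x.2))%:E)%E.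
  apply: eq_integral => x _; congr EFin; rewrite /phi !normal_pdfE ?oner_eq0// /normal_fun /normal_peak.
  rewrite !subr0 expr1n mul1r [pi *+ 2]mulr2n.
  set c := Num.sqrt _.
  have c2 : c ^+ 2 = 2 * pi by rewrite sqr_sqrtr; [ring|exact: (addr_ge0 (pi_ge0 R) (pi_ge0 R))].
  have c0 : c != 0 by apply/eqP => cz; move: c2; rewrite cz expr0n/=; have := pi_gt0 R; lra.
  rewrite mulrACA -expRD -invfM -expr2 c2 mulrA; congr (_ * expR _).
    by rewrite invfM mulrA divff ?mul1r.
  by rewrite mulr2n; field.
have mphi2 : measurable_fun setT (fun x : measurableTypeR R * measurableTypeR R => phi x.1 * phi x.2).
  by apply: measurable_funM; apply: measurableT_comp.
under eq_integral do rewrite EFinM.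
rewrite ge0_integralZl_EFin//; last 2 first.
  by move=> x _; rewrite lee_fin mulr_ge0.
  exact/measurable_EFinP.
rewrite fubini_tonelli1; last 2 first.
  exact/measurable_EFinP.
  by move=> x; rewrite lee_fin mulr_ge0.
rewrite /fubini_F/=; under eq_integral => x _.
  under eq_integral do rewrite EFinM.
  rewrite ge0_integralZl_EFin//; last 2 first.
    by move=> y _; rewrite lee_fin.
    exact/measurable_EFinP.
  rewrite intphi mule1; over.
by rewrite intphi mule1.
Qed.

Context {d : measure_display} {T : measurableType d} {P : probability T R}.
Implicit Types X : T -> R[i].

Lemma gaussian_square_le X a b s : standard_complex_gaussian P X -> 0 < s ->
  (P ((@plane R \o X) @^-1` square a b s) <= (s ^+ 2)%:E)%E.
Proof.
move=> [_ XP] s0; rewrite XP; last exact: measurable_square.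
apply: (@le_trans _ _ (\int[lebesgue2]_(x in square a b s) (cst 1 x))%E).
  apply: ge0_le_integral => //.
  - exact: measurable_square.
  - by move=> x _; rewrite lee_fin gaussian_density_ge0.
  - by apply: measurable_funTS; apply/measurable_EFinP; exact: measurable_gaussian_density.
  - by move=> x _; rewrite lee_fin gaussian_density_le1.
by rewrite integral_cst; [rewrite mul1e -(lebesgue_square a b s0)|exact: measurable_square].
Qed.

Lemma gaussian_square_ge X a b s K : standard_complex_gaussian P X -> 0 < s ->
  (forall x, square a b s x -> x.1 ^+ 2 + x.2 ^+ 2 <= K) ->
  ((s ^+ 2 * (pi^-1 * expR (- K)))%:E <= P ((@plane R \o X) @^-1` square a b s))%E.
Proof.
move=> [_ XP] s0 sK; rewrite XP; last exact: measurable_square.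
apply: (@le_trans _ _ (\int[lebesgue2]_(x in square a b s) (cst (pi^-1 * expR (- K))%:E x))%E).
  rewrite integral_cst; last exact: measurable_square.
  by rewrite mulrC EFinM -(lebesgue_square a b s0).
apply: ge0_le_integral => //.
- exact: measurable_square.
- by move=> x _; rewrite lee_fin mulr_ge0 ?invr_ge0 ?pi_ge0 ?expR_ge0.
- by apply: measurable_funTS; apply/measurable_EFinP; exact: measurable_gaussian_density.
- move=> x xs; rewrite lee_fin ler_wpM2l ?invr_ge0 ?pi_ge0// ler_expR lerN2.
  exact: sK.
Qed.

Definition outside_disc (l : R) : set (measurableTypeR R * measurableTypeR R) :=
  [set x | l ^+ 2 < x.1 ^+ 2 + x.2 ^+ 2].

Lemma measurable_outside_disc l : measurable (outside_disc l).
Proof.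
rewrite -[outside_disc l]setTI.
have := measurable_radius measurableT (@measurable_itv R `]l ^+ 2, +oo[).
by congr (measurable (_ `&` _)); apply/seteqP; split => x /=; rewrite in_itv/= andbT.
Qed.

(** Outside the disc, half of the exponent is bounded by its value on the circle and the other half
    is integrated. The sharp tail [exp (- l ^ 2)] would call for polar coordinates. *)
Lemma gaussian_tail X l : standard_complex_gaussian P X ->
  (P ((@plane R \o X) @^-1` outside_disc l) <= (2 * expR (- (l ^+ 2 / 2)))%:E)%E.
Proof.
move=> [_ XP]; rewrite XP; last exact: measurable_outside_disc.
pose g (x : measurableTypeR R * measurableTypeR R) : R :=
  pi^-1 * expR (- (x.1 ^+ 2 + x.2 ^+ 2) / 2).
have mg : measurable_fun setT g.
  apply: measurable_funM => //; apply: measurableT_comp => //.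
  apply: measurable_funM => //; apply: measurableT_comp => //; exact: measurable_radius.
have g0 x : 0 <= g x by rewrite mulr_ge0 ?invr_ge0 ?pi_ge0 ?expR_ge0.
apply: (@le_trans _ _ (\int[lebesgue2]_(x in outside_disc l)
    ((expR (- (l ^+ 2 / 2)))%:E * (g x)%:E))%E).
  apply: ge0_le_integral => //.
  - exact: measurable_outside_disc.
  - by move=> x _; rewrite lee_fin gaussian_density_ge0.
  - by apply: measurable_funTS; apply/measurable_EFinP; exact: measurable_gaussian_density.
  - apply: measurable_funTS; apply/measurable_EFinP.
    by apply: measurable_funM.
  - move=> x; rewrite /outside_disc/= => xl.
    rewrite -EFinM lee_fin /g mulrCA ler_wpM2l ?invr_ge0 ?pi_ge0//.
    rewrite -expRD ler_expR.
    by set y := x.1 ^+ 2 + x.2 ^+ 2 in xl *; set m := l ^+ 2 in xl *; lra.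
rewrite ge0_integralZl_EFin ?expR_ge0//; last 3 first.
  exact: measurable_outside_disc.
  by move=> x _; rewrite lee_fin.
  by apply: measurable_funTS; exact/measurable_EFinP.
rewrite [(2 * _)%R]mulrC EFinM lee_pmul2l ?lte_fin ?expR_gt0//.
rewrite -integral_exp_half; apply: ge0_subset_integral => //.
- exact: measurable_outside_disc.
- exact/measurable_EFinP.
- by move=> x _; rewrite lee_fin.
Qed.

End GaussianEstimates.

(** * Covering an event by grid cells *)

Section CellCover.
Context {R : realType} {d : measure_display} {T : measurableType d}.
Context {P : probability T R} {I : choiceType} {X : I -> T -> R[i]}.
Hypothesis X_gaussian : forall i, standard_complex_gaussian P (X i).
Hypothesis X_indep : mutually_independent P X.

Lemma independent_preimages (s : seq I)
    (A : I -> set (measurableTypeR R * measurableTypeR R)) :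
  uniq s -> (forall i, measurable (A i)) ->
  let C := [set t | forall i, i \in s -> A i (plane (X i t))] in
  measurable C /\ P C = (\prod_(i <- s) P ((@plane R \o X i) @^-1` A i))%E.
Proof.
move=> us mA C.
pose J : {fset I} := [fset i in s]%fset.
have JE i : (i \in J) = (i \in s) by rewrite inE.
have CE : C = \bigcap_(i in [set` J]) ((@plane R \o X i) @^-1` A i).
  by apply/seteqP; split => t /= Ct i; have := Ct i; rewrite /= JE.
rewrite CE X_indep//; split.
  apply: fin_bigcap_measurable => [|i _]; first exact: finite_fset.
  by rewrite -[_ @^-1` _]setTI; apply: (X_gaussian i).1.
by apply: perm_big; apply: uniq_perm.
Qed.

Context {eta : R}.
Hypothesis eta_gt0 : 0 < eta.

Definition grid_cell (c : int * int) :=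
  square (c.1%:~R * eta) (c.2%:~R * eta) eta.

Definition cell_index (x : R) : int := Num.floor (x / eta).

Lemma cell_indexP (z : R[i]) :
  grid_cell (cell_index (complex.Re z), cell_index (complex.Im z)) (plane z).
Proof.
have H x : (cell_index x)%:~R * eta <= x < (cell_index x)%:~R * eta + eta.
  have := floor_itv (x / eta); rewrite intrD /cell_index.
  by rewrite ler_pdivlMr// ltr_pdivrMr// mulrDl mul1r.
by split; rewrite /= in_itv/= H.
Qed.

Lemma grid_cell_close c (z w : R[i]) :
  grid_cell c (plane z) -> grid_cell c (plane w) -> normc (z - w) <= 2 * eta.
Proof.
move=> zc wc; apply: (le_trans (normc_leD _)).
case: z w zc wc => [x y] [x' y'] [/=]; rewrite !in_itv/= => /andP[h1 h2] /andP[h3 h4].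
move=> [/=]; rewrite !in_itv/= => /andP[h5 h6] /andP[h7 h8].
rewrite mulr2n mulrDl mul1r; apply: lerD; rewrite ler_norml; apply/andP; split; lra.
Qed.

(** An interval of length [2 * S] meets at most [floor (2 * S / eta) + 2] grid intervals of length
    [eta]. *)
Definition cells_near (z : R[i]) (S : R) : seq (int * int) :=
  let N := (Num.truncn (2 * S / eta)).+2 in
  [seq (cell_index (complex.Re z - S) + k%:Z, cell_index (complex.Im z - S) + l%:Z)
    | k <- iota 0 N, l <- iota 0 N].

Lemma size_cells_near z S : eta <= S ->
  (size (cells_near z S))%:R * eta ^+ 2 <= (4 * S) ^+ 2.
Proof.
move=> etaS; rewrite size_allpairs !size_iota natrM -expr2 -exprMn.
have S0 : 0 < S by apply: lt_le_trans etaS.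
rewrite lerXn2r ?nnegrE ?mulr_ge0 ?(ltW S0) ?(ltW eta_gt0)//.
have := truncn_le (2 * S / eta).
rewrite [RHS]divr_ge0 ?mulr_ge0 ?(ltW S0) ?(ltW eta_gt0)// ler_pdivlMr// => h; rewrite -addn2 natrD mulrDl.
by lra.
Qed.

Lemma cells_nearP z w S : normc (w - z) <= S ->
  exists2 c, c \in cells_near z S & grid_cell c (plane w).
Proof.
move=> wzS.
exists (cell_index (complex.Re w), cell_index (complex.Im w)); last exact: cell_indexP.
have near (a b : R) : `|b - a| <= S -> exists2 k,
    (k < (Num.truncn (2 * S / eta)).+2)%N & cell_index b = cell_index (a - S) + k%:Z.
  rewrite ler_norml => /andP[h1 h2].
  have ab : cell_index (a - S) <= cell_index b.
    by apply: le_floor; rewrite ler_wpM2r ?invr_ge0 ?(ltW eta_gt0)//; lra.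
  exists `|cell_index b - cell_index (a - S)|%N.
    rewrite -ltz_nat gez0_abs ?subr_ge0// -(ltr_int R) intrB.
    have b1 : (cell_index b)%:~R <= b / eta by exact: floor_le.
    have a1 : (a - S) / eta < (cell_index (a - S))%:~R + 1.
      by have := floorD1_gt ((a - S) / eta); rewrite intrD.
    have t1 : 2 * S / eta < (Num.truncn (2 * S / eta)).+1%:R by exact: truncnS_gt.
    have ba : b / eta <= (a - S) / eta + 2 * S / eta.
      by rewrite -mulrDl ler_wpM2r ?invr_ge0 ?(ltW eta_gt0)//; lra.
    by rewrite -pmulrn -[_.+2]addn1 natrD; lra.
  by rewrite gez0_abs ?subr_ge0// [RHS]addrC subrK.
have [k kN kE] : exists2 k, (k < (Num.truncn (2 * S / eta)).+2)%N &
    cell_index (complex.Re w) = cell_index (complex.Re z - S) + k%:Z.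
  by apply: near; apply: le_trans wzS; case: (w) (z) => [? ?] [? ?]; exact: (normRe_le (_ +i* _)).
have [l lN lE] : exists2 l, (l < (Num.truncn (2 * S / eta)).+2)%N &
    cell_index (complex.Im w) = cell_index (complex.Im z - S) + l%:Z.
  by apply: near; apply: le_trans wzS; case: (w) (z) => [? ?] [? ?]; exact: (normIm_le (_ +i* _)).
rewrite kE lE; apply/allpairsP; exists (k, l); rewrite !mem_iota//.
Qed.

Definition in_cells (s : seq I) (c : I -> int * int) :=
  [set t | forall i, i \in s -> grid_cell (c i) (plane (X i t))].

Lemma in_cells_measurable s c : uniq s -> measurable (in_cells s c) /\
  (P (in_cells s c) <= ((eta ^+ 2) ^+ size s)%:E)%E.
Proof.
move=> us; have [|mC ->] := independent_preimages us (A := fun i => grid_cell (c i)).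
  by move=> i; exact: measurable_square.
split=> //.
elim: s {us mC} => [|i s IH]; first by rewrite big_nil expr0.
rewrite big_cons [_ ^+ size _]exprS EFinM; apply: lee_pmul => //.
- by apply: prode_ge0 => j _.
- exact: gaussian_square_le.
Qed.

(* The outcomes of [E] are sorted by the grid cells of [X i], [i] running
   through [s]. Once the cells of the previous variables are known, [X i] is
   confined to a disc, which meets few cells. The mesh size cancels: the number
   of cells is inversely proportional to the probability of a cell. *)
Lemma cell_cover (E : set T) (s : seq I) (S : I -> R) : uniq s ->
  (forall i, eta <= S i) ->
  (forall s1 i s2 t t', s = s1 ++ i :: s2 -> E t -> E t' ->
    (forall j, j \in s1 -> normc (X j t - X j t') <= 2 * eta) ->
    normc (X i t - X i t') <= S i) ->
  exists B, [/\ measurable B, E `<=` B &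
    (P B <= (\prod_(i <- s) (4 * S i) ^+ 2)%:E)%E].
Proof.
move=> us etaS confined.
have b_ge0 k (r : seq I) : 0 <= (eta ^+ 2) ^+ k * \prod_(j <- r) (4 * S j) ^+ 2.
  rewrite mulr_ge0 ?exprn_ge0 ?(ltW eta_gt0)// big_seq prodr_ge0// => j _.
  exact: sqr_ge0.
(* The cells of the variables in [s1] are prescribed by [c], at a cost of [eta ^+ 2] each; the
   induction runs over the variables still free. *)
suff : forall s2 s1 c, s = s1 ++ s2 -> exists B, [/\ measurable B,
    E `&` in_cells s1 c `<=` B &
    (P B <= ((eta ^+ 2) ^+ size s1 * \prod_(i <- s2) (4 * S i) ^+ 2)%:E)%E].
  move=> /(_ s [::] (fun=> (0, 0)) erefl)[B [mB EB PB]]; exists B; split=> //.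
    by move=> t Et; apply: EB.
  by move: PB; rewrite expr0 mul1r.
elim=> [|i s2 IH] s1 c sE.
  have us1 : uniq s1 by move: us; rewrite sE cats0.
  have [mC PC] := in_cells_measurable c us1.
  by exists (in_cells s1 c); split=> [||] //; rewrite big_nil mulr1.
have i_s1 : i \notin s1.
  by move: us; rewrite sE cat_uniq /= => /and3P[_ /norP[]].
(* Any outcome of [E] in the prescribed cells serves as centre for the disc of the next variable;
   without one, the empty set is a cover. *)
have [[t0 [Et0 ct0]]|none] := pselect (exists t, E t /\ in_cells s1 c t); last first.
  exists set0; split => //; first by move=> t Et; apply: none; exists t.
  by rewrite measure0 lee_fin.
pose b := (eta ^+ 2) ^+ (size s1).+1 * \prod_(j <- s2) (4 * S j) ^+ 2.
have cover (r : seq (int * int)) : exists B, [/\ measurable B,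
    E `&` in_cells s1 c `&` [set t | exists2 v, v \in r & grid_cell v (plane (X i t))]
      `<=` B & (P B <= ((size r)%:R * b)%:E)%E].
  elim: r => [|v r [B [mB EB PB]]].
    exists set0; split => //; first by move=> t [_ [v]].
    by rewrite measure0 mul0r.
  have sE' : s = rcons s1 i ++ s2 by rewrite cat_rcons.
  have [B' [mB' EB' PB']] := IH _ (fun j => if j == i then v else c j) sE'.
  exists (B' `|` B); split; first exact: measurableU.
    move=> t [[Et ct] [w]]; rewrite inE => /predU1P[->|wr] tw; [left|right].
      apply: EB'; split=> // j; rewrite mem_rcons inE => /predU1P[->|js1].
        by rewrite eqxx.
      by case: eqP => [ji|_]; [move: i_s1; rewrite -ji js1|exact: ct].
    by apply: EB; split => //; exists w.
  apply: (le_trans (measureU2 _ mB' mB)).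
  rewrite /= -add1n natrD mulrDl mul1r EFinD; apply: leeD => //.
  by rewrite /b -(size_rcons s1 i).
have [B [mB EB PB]] := cover (cells_near (X i t0) (S i)).
exists B; split=> //.
  move=> t [Et ct]; apply: EB; split => //; apply: cells_nearP.
  apply: (confined s1 i s2) => // j js1.
  exact: grid_cell_close (ct j js1) (ct0 j js1).
apply: (le_trans PB); rewrite lee_fin big_cons /b [_ ^+ _.+1]exprS.
rewrite -[eta ^+ 2 * _ * _]mulrA [leLHS]mulrA [leRHS]mulrCA.
by rewrite ler_wpM2r ?size_cells_near.
Qed.

End CellCover.

(** * Measurability of the hole event *)

Section CountableQuantifiers.
Context {d : measure_display} {T : measurableType d} {I : countType}.
Implicit Types A : I -> T -> Prop.

Lemma measurable_forall A : (forall i, measurable [set t | A i t]) ->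
  measurable [set t | forall i, A i t].
Proof.
move=> mA; pose B k := if choice.unpickle k is Some i then [set t | A i t] else setT.
rewrite (_ : mkset _ = \bigcap_k B k); last first.
  apply/seteqP; split => t /= At.
    by move=> k _; rewrite /B; case: choice.unpickle.
  by move=> i; have := At (choice.pickle i) Logic.I; rewrite /B choice.pickleK.
by apply: bigcapT_measurable => k; rewrite /B; case: choice.unpickle.
Qed.

Lemma measurable_exists A : (forall i, measurable [set t | A i t]) ->
  measurable [set t | exists i, A i t].
Proof.
move=> mA; rewrite -[mkset _]setCK; apply: measurableC.
rewrite (_ : ~` _ = [set t | forall i, ~ A i t]); last first.
  by apply/seteqP; split => t /= /forallNP.
by apply: measurable_forall => i; apply: measurableC; exact: mA.
Qed.

Lemma measurable_imply (Q : Prop) (B : T -> Prop) : (Q -> measurable [set t | B t]) ->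
  measurable [set t | Q -> B t].
Proof.
have [q|nq] := pselect Q; move=> mB.
  by rewrite (_ : mkset _ = [set t | B t]); [exact: mB|apply/seteqP; split => t /=; [exact|]].
by rewrite (_ : mkset _ = setT)//; apply/seteqP; split => t //= _ /nq.
Qed.

End CountableQuantifiers.

Section HoleMeasurable.
Context {R : realType} {n : nat} {d : measure_display} {T : measurableType d}.
Context {omega : multi_index n -> T -> R[i]}.
Hypothesis omega_measurable : forall j, measurable_fun setT (@plane R \o omega j).

Definition coefficient t (j : multi_index n) : R[i] := omega j t * (weight j)%:C.

Lemma psiE t (z : 'rV[R[i]]_n) :
  psi omega t z = power_series (coefficient t) (fun i => z 0 i).
Proof.
apply: (congr1 (fun a : multi_index n -> R[i]^o => sum a)); apply/funext => j.
by rewrite /coefficient /weight fmorphV /= mulrAC mulrA.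
Qed.

Lemma in_ball (r : R) (z : 'rV[R[i]]_n) : 0 < r ->
  (euclidean_norm z < r) = (\sum_i normc (z 0 i) ^+ 2 < r ^+ 2).
Proof.
move=> r0; rewrite /euclidean_norm -{1}(ger0_norm (ltW r0)) -sqrtr_sqr ltr_sqrt//.
by rewrite exprn_gt0.
Qed.

Definition ball_radii (r : R) (q : 'rV[rat]_n) := (forall i, 0 <= q 0 i) /\
  \sum_i (ratr (q 0 i) : R) ^+ 2 < r ^+ 2.

Let radii (q : 'rV[rat]_n) (i : 'I_n) : R := ratr (q 0 i).

Lemma ball_radii_cover (r : R) (z : 'I_n -> R[i]) :
  \sum_i normc (z i) ^+ 2 < r ^+ 2 ->
  exists2 q, ball_radii r q & forall i, normc (z i) < radii q i.
Proof.
move=> zr; set s := \sum_i _ in zr.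
pose C := \sum_i (2 * normc (z i) + 1).
have C0 : 0 <= C by apply: sumr_ge0 => i _; rewrite addr_ge0 ?mulr_ge0 ?normc_ge0.
(* With [e <= 1] one has [e ^ 2 <= e], so enlarging each modulus by [e] adds at most [e * C] to the
   sum of squares. *)
pose e := Num.min 1 ((r ^+ 2 - s) / (C + 1)).
have e0 : 0 < e by rewrite lt_min ltr01 divr_gt0 ?subr_gt0// ltr_wpDl.
have rat_above (a : R) : exists p : rat, a < ratr p < a + e.
  have [|p] := @rat_in_itvoo _ a (a + e); first by rewrite ltrDl.
  by rewrite in_itv/= => ap; exists p.
pose q : 'rV[rat]_n := \row_i projT1 (cid (rat_above (normc (z i)))).
have qz i : normc (z i) < radii q i < normc (z i) + e.
  by rewrite /radii mxE; case: cid.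
exists q; last by move=> i; case/andP: (qz i).
split=> [i|].
  rewrite -(ler0q R); apply: (le_trans (normc_ge0 (z i))).
  by apply: ltW; case/andP: (qz i).
apply: (@le_lt_trans _ _ (\sum_i (normc (z i) ^+ 2 + e * (2 * normc (z i) + 1)))).
  apply: ler_sum => i _; have /andP[h1 h2] := qz i.
  have z0 := normc_ge0 (z i).
  apply: (@le_trans _ _ ((normc (z i) + e) ^+ 2)).
    rewrite lerXn2r ?nnegrE ?addr_ge0 ?(ltW e0)//.
      exact: le_trans z0 (ltW h1).
    exact: ltW.
  rewrite sqrrD -addrA lerD2l.
  have e1 : e <= 1 by rewrite ge_min lexx.
  have := ltW e0; nra.
rewrite big_split/= -mulr_sumr -/s -/C addrC -ltrBrDr.
have eC : e * (C + 1) <= r ^+ 2 - s.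
  by rewrite -ler_pdivlMr ?ltr_wpDl// ge_min lexx orbT.
by apply: lt_le_trans eC; rewrite ltr_pM2l// ltrDl.
Qed.

(** Quantifying over truncations and rational points only makes this a countable combination of
    events, each about finitely many coefficients. *)
Definition nonvanishing_near_radii (q : 'rV[rat]_n) t :=
  converges_on (coefficient t) (radii q) /\
  exists k N0 : nat, forall N (w : 'rV[rat]_(n + n)), (N0 <= N)%N ->
    polydisc (radii q) (rational_point w) ->
    k.+1%:R^-1 <= normc (truncation (coefficient t) N (rational_point w)).

(** Polydiscs with rational radii exhaust the ball. On a closed polydisc, compactness and uniform
    convergence turn nonvanishing into a lower bound for all long truncations; density of the
    rational points gives the converse. *)
Lemma hole_countable (r : R) : 0 < r ->
  hole omega r = [set t | forall q, ball_radii r q -> nonvanishing_near_radii q t].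
Proof.
move=> r0; apply/seteqP; split => t /= Ht.
  move=> q [q0 qr].
  have q0' i : 0 <= radii q i by rewrite /radii ler0q.
  have in_hole z : polydisc (radii q) z -> power_series (coefficient t) z != 0.
    move=> zq; have := Ht (\row_i z i); rewrite psiE in_ball//.
    have -> : (fun i => (\row_i z i) 0 i) = z by apply/funext => i; rewrite mxE.
    apply; apply: le_lt_trans qr; apply: ler_sum => i _.
    by rewrite ?mxE lerXn2r ?nnegrE ?normc_ge0// -/(radii q i).
  have fq : converges_on (coefficient t) (radii q).
    (* At this corner [psi] is nonzero, hence not the default value of a divergent sum, and the
       terms there dominate all others. *)
    have polyq : polydisc (radii q) (fun i => (radii q i)%:C).
      by move=> i; rewrite normc_real ger0_norm.
    have [B HB] := sum_neq0_abs_bounded (in_hole _ polyq).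
    exists B => s us; apply: le_trans (HB s us).
    apply: ler_sum => j _; rewrite [leRHS]normcM /monomial normc_prod.
    rewrite le_eqVlt; apply/orP; left; apply/eqP; congr (_ * _).
    by apply: eq_bigr => i _; rewrite normcX normc_real ger0_norm.
  split => //; have [e e0 eP] := power_series_min fq q0' in_hole.
  have [N0 NP] := truncation_unif_cvg fq q0' (divr_gt0 e0 (ltr0n R 2)).
  exists (Num.truncn (2 / e)), N0 => N w N0N wq.
  have h1 := eP _ wq; have h2 := NP N _ N0N wq.
  have h3 := le_trans (lerB_normc _ _) h2.
  apply: (@le_trans _ _ (e / 2)); last by lra.
  rewrite invf_ple ?posrE ?divr_gt0// invf_div.
  by apply: ltW; exact: truncnS_gt.
move=> z; rewrite in_ball// => /ball_radii_cover[q qr zq].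
have [fq [k [N0 kP]]] := Ht q qr; rewrite psiE.
have q0 i : 0 <= radii q i by apply: (le_trans (normc_ge0 (z 0 i))); exact: ltW.
have k0 : 0 < k.+1%:R^-1 :> R by rewrite invr_gt0.
apply: (power_series_neq0_dense fq (divr_gt0 k0 (ltr0n R 2))) => // w wq.
have [N1 NP] := truncation_unif_cvg fq q0 (divr_gt0 k0 (ltr0n R 2)).
have h1 := kP (maxn N0 N1) w (leq_maxl _ _) wq.
have h2 := NP (maxn N0 N1) _ (leq_maxr _ _) wq.
rewrite normcBC in h2; have h3 := le_trans (lerB_normc _ _) h2.
by move: (k.+1%:R^-1) (normc (power_series _ _)) k0 h1 h3 {h2} => c x; lra.
Qed.

Lemma coefficient_coordinates j :
  coordinatewise (fun g : T -> R => measurable_fun setT g) (fun t => coefficient t j).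
Proof.
have mc : forall c : R, measurable_fun setT (fun _ : T => c) by [].
apply: (@coordinatewise_mul R T (fun g : T -> R => measurable_fun setT g)) => //.
- by move=> f g mf mg; exact: measurable_funD.
- by move=> f g mf mg; exact: measurable_funM.
by have [m1 m2] := (measurable_fun_pairP _).1 (omega_measurable j).
Qed.

Lemma measurable_normc2_truncation N z : measurable_fun setT
  (fun t => normc (truncation (coefficient t) N z) ^+ 2).
Proof.
have mD (f g : T -> R) : measurable_fun setT f -> measurable_fun setT g ->
  measurable_fun setT (fun x => f x + g x) by exact: measurable_funD.
have mM (f g : T -> R) : measurable_fun setT f -> measurable_fun setT g ->
  measurable_fun setT (fun x => f x * g x) by exact: measurable_funM.
apply: (coordinatewise_normc2 mD mM).
apply: (@coordinatewise_truncation R T _ _ mD mM n (fun j t => coefficient t j) N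
  (fun i _ => z i)) => //.
by move=> j; exact: coefficient_coordinates.
Qed.

Lemma measurable_ge_set (g : T -> R) (c : R) : measurable_fun setT g ->
  measurable [set t | c <= g t].
Proof.
move=> mg; have := mg measurableT _ (@measurable_itv R `[c, +oo[).
by rewrite setTI; congr measurable; apply/seteqP; split => t /=; rewrite in_itv/= andbT.
Qed.

Lemma hole_measurable (r : R) : 0 < r -> measurable (hole omega r).
Proof.
move=> r0; rewrite hole_countable//.
apply: measurable_forall => q; apply: measurable_imply => -[q0 qr].
have q0' i : 0 <= radii q i by rewrite /radii ler0q.
have mnormc j : measurable_fun setT (fun t => normc (coefficient t j)).
  rewrite (_ : (fun t => _) = Num.sqrt \o (fun t => normc (coefficient t j) ^+ 2)).
    apply: measurableT_comp.
      exact: (continuous_measurable_fun (@sqrt_continuous R)).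
    apply: (@coordinatewise_normc2 R T (fun g => measurable_fun setT g)).
    - by move=> f g mf mg; exact: measurable_funD.
    - by move=> f g mf mg; exact: measurable_funM.
    - exact: coefficient_coordinates.
  by apply/funext => t /=; rewrite sqrtr_sqr ger0_norm ?normc_ge0.
have mconv : measurable [set t | converges_on (coefficient t) (radii q)].
  (* A bound on the simplices suffices, because they exhaust the finite sets of indices; the signs
     are reversed to fit [measurable_ge_set]. *)
  have -> : [set t | converges_on (coefficient t) (radii q)] =
      [set t | exists B : nat, forall N : nat,
      - B%:R <= - \sum_(j <- simplex N) normc (coefficient t j) * monomial (radii q) j].
    apply/seteqP; split => t /=.
      move=> [B HB]; exists (Num.truncn B).+1 => N; rewrite lerN2.
      by apply: (le_trans (HB _ (uniq_simplex N))); apply: ltW; exact: truncnS_gt.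
    move=> [B HB]; exists B%:R => s us; have [N sN] := sub_simplex s.
    have := HB N; rewrite lerN2; apply: le_trans; apply: ler_sum_sub => // j.
    by rewrite mulr_ge0 ?normc_ge0//; apply: prodr_ge0 => i _; exact: exprn_ge0.
  apply: measurable_exists => B; apply: measurable_forall => N.
  apply: measurable_ge_set; apply: measurableT_comp => //.
  by apply: measurable_sum => j; exact: measurable_funM.
apply: (measurableI _ _ mconv).
apply: measurable_exists => k; apply: measurable_exists => N0.
apply: measurable_forall => N; apply: measurable_forall => w.
apply: measurable_imply => _; apply: measurable_imply => _.
have -> : [set t | k.+1%:R^-1 <= normc (truncation (coefficient t) N (rational_point w))]
  = [set t | k.+1%:R^-1 ^+ 2 <=
   normc (truncation (coefficient t) N (rational_point w)) ^+ 2].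
  by apply/seteqP; split => t /=; rewrite ler_sqr ?nnegrE ?normc_ge0.
by apply: measurable_ge_set; exact: measurable_normc2_truncation.
Qed.

End HoleMeasurable.

(** * Lower bound *)

Section UnionBound.
Context {R : realType} {d : measure_display} {T : measurableType d}.
Context {P : probability T R} {I : countType}.

(** Keeping [A] inside the probability allows bounds [v i] proportional to [P A], as independence
    provides them, in place of conditional probabilities. *)
Lemma countable_union_bound (A : set T) (B : I -> set T) (v : I -> R) (b : R) :
  measurable A -> (forall i, measurable (B i)) -> (forall i, 0 <= v i) ->
  (forall s, uniq s -> \sum_(i <- s) v i <= b) ->
  (forall i, P (A `&` B i) <= (v i)%:E)%E ->
  (P (A `&` [set t | exists i, B i t]) <= b%:E)%E.
Proof.
move=> mA mB v0 vb AB.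
pose B' k := if (choice.pickle_inv k : option I) is Some i then A `&` B i else set0.
have mB' k : measurable (B' k).
  by rewrite /B'; case: choice.pickle_inv => // i; exact: measurableI.
have E : A `&` [set t | exists i, B i t] = \bigcup_k B' k.
  apply/seteqP; split => t /=.
    move=> [At [i Bi]]; exists (choice.pickle i) => //.
    by rewrite /B' choice.pickleK_inv.
  move=> [k _]; rewrite /B'; case: choice.pickle_inv => // i [At Bi].
  by split => //; exists i.
rewrite E; apply: (@le_trans _ _ (\sum_(0 <= k <oo) P (B' k))%E).
  by apply: generalized_Boole_inequality => //; exact: bigcupT_measurable.
apply: lime_le; first by apply: is_cvg_nneseries => *.
apply: nearW => N; rewrite /index_iota subn0.
apply: (@le_trans _ _ (\sum_(i <- pmap (@choice.pickle_inv I) (iota 0 N)) v i)%:E).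
  rewrite -sumEFin; elim: (iota 0 N) => [|k s IH]; first by rewrite !big_nil.
  rewrite big_cons /=; case E' : ((choice.pickle_inv k : option I)) => [i|] /=.
    by rewrite big_cons leeD// /B' E'.
  by rewrite {1}/B' E' measure0 add0e.
rewrite lee_fin; apply: vb; apply: pmap_uniq (iota_uniq _ _).
exact: choice.pickle_invK.
Qed.

End UnionBound.

Section LowerBound.
Context {R : realType} {n : nat} {d : measure_display} {T : measurableType d}.
Context {omega : multi_index n -> T -> R[i]}.

(* The loss in [monomial_weight_le] for the ratio [b = 16], which beats the growth
   [2 ^+ total_degree j] of the remaining coefficients. *)
Definition gauge (r : R) := expR (128 * n%:R * r ^+ 2).

Lemma term_le t (z : 'I_n -> R[i]) (r : R) j :
  0 <= r -> (forall i, normc (z i) <= r) ->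
  normc (coefficient (omega := omega) t j * monomial z j) <=
  normc (omega j t) * (16^-1 ^+ total_degree j * gauge r).
Proof.
move=> r0 zr; rewrite normcM [normc (coefficient _ _)]normcM normc_real.
rewrite ger0_norm ?(ltW (weight_gt0 j))// -mulrA ler_wpM2l ?normc_ge0// mulrC.
apply: le_trans (monomial_weight_le j r0 (_ : 0 < 16) zr) _ => //.
rewrite ler_wpM2l ?exprn_ge0 ?invr_ge0// ler_expR exprMn.
by rewrite le_eqVlt; apply/orP; left; apply/eqP; field.
Qed.

(** The nonconstant terms are at most [tau * 2^-1 ^+ total_degree j] and add up to at most
    [tau * 2 ^+ n <= 1], less than the constant term. *)
Lemma hole_sufficient t (r tau delta : R) L :
  0 < r -> 2 <= normc (omega [ffun=> 0%N] t) ->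
  (forall j, (0 < total_degree j <= L)%N -> normc (omega j t) <= delta) ->
  (forall j, (L < total_degree j)%N -> normc (omega j t) <= 2 ^+ total_degree j) ->
  delta * gauge r <= tau -> 4^-1 ^+ L * gauge r <= tau -> tau * 2 ^+ n <= 1 ->
  hole omega r t.
Proof.
move=> r0 w0 low high dtau Ltau tau1 z; rewrite in_ball// psiE => zr.
have {}zr i : normc (z 0 i) <= r.
  rewrite -ler_sqr ?nnegrE ?normc_ge0 ?(ltW r0)//; apply: le_trans (ltW zr).
  by rewrite (bigD1 i)//= lerDl sumr_ge0// => k _; exact: sqr_ge0.
set a := fun j => coefficient (omega := omega) t j * monomial (fun i => z 0 i) j.
have g0 : 0 < gauge r by exact: expR_gt0.
have aj j : (0 < total_degree j)%N -> normc (a j) <= tau * 2^-1 ^+ total_degree j.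
  move=> j0; apply: (le_trans (term_le t j (ltW r0) zr)).
  have [jL|Lj] := leqP (total_degree j) L.
    apply: (@le_trans _ _ (delta * (2^-1 ^+ total_degree j * gauge r))).
      apply: ler_pM; rewrite ?normc_ge0 ?mulr_ge0 ?exprn_ge0 ?(ltW g0) ?invr_ge0//.
        by apply: low; rewrite j0.
      by rewrite ler_wpM2r ?(ltW g0)// lerXn2r ?nnegrE ?invr_ge0// lef_pV2 ?posrE// ler_nat.
    by rewrite mulrCA mulrC ler_wpM2r// exprn_ge0 ?invr_ge0.
  apply: (@le_trans _ _ (2 ^+ total_degree j * (16^-1 ^+ total_degree j * gauge r))).
    by rewrite ler_wpM2r ?mulr_ge0 ?exprn_ge0 ?(ltW g0) ?invr_ge0// high.
  rewrite mulrA -exprMn.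
  have -> : 2 * 16^-1 = 4^-1 * 2^-1 :> R by field.
  rewrite exprMn mulrAC ler_wpM2r ?exprn_ge0 ?invr_ge0//; apply: le_trans Ltau.
  rewrite ler_wpM2r ?(ltW g0)// ler_wiXn2l ?invr_ge0 ?invf_le1 ?ler1n//.
  exact: ltnW.
have tau0 : 0 <= tau by apply: le_trans Ltau; rewrite mulr_ge0 ?exprn_ge0 ?invr_ge0 ?(ltW g0).
have tailP s : uniq s -> {in s, forall j, j \notin [:: [ffun=> 0%N] : multi_index n]} ->
    \sum_(j <- s) normc (a j) <= 1.
  move=> us s0; apply: le_trans tau1.
  apply: (@le_trans _ _ (\sum_(j <- s) tau * 2^-1 ^+ total_degree j)).
    rewrite big_seq [leRHS]big_seq; apply: ler_sum => j /s0; rewrite inE => j0.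
    apply: aj; rewrite lt0n; apply: contra j0 => /eqP j0; apply/eqP/ffunP => i.
    by have := index_le_degree j i; rewrite j0 leqn0 ffunE => /eqP.
  by rewrite -mulr_sumr ler_wpM2l// sum_geometric_le.
(* Convergence is part of the claim: a divergent sum would take the value [0]. *)
have ab : abs_bounded a.
  exists (normc (a [ffun=> 0%N]) + 1) => s us; rewrite (bigID (pred1 [ffun=> 0%N]))/=.
  apply: lerD.
    rewrite -big_filter.
    have := @ler_sum_sub R _ [seq x <- s | x == [ffun=> 0%N]] [:: [ffun=> 0%N]]
      (fun j => normc (a j)) (filter_uniq _ us); rewrite big_seq1; apply.
      by move=> j; rewrite mem_filter inE => /andP[].
    by move=> j; exact: normc_ge0.
  rewrite -big_filter; apply: tailP; first by rewrite filter_uniq.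
  by move=> j; rewrite mem_filter inE => /andP[].
have := normc_sum_sub_le ab (_ : uniq [:: [ffun=> 0%N]]) tailP.
rewrite big_seq1 => /(_ isT) h.
apply/eqP => E; move: h; rewrite [sum _](_ : _ = 0)//.
rewrite sub0r normc_opp /a normcM.
have -> : monomial (fun i => z 0 i) [ffun=> 0%N] = 1.
  by rewrite /monomial big1// => i _; rewrite ffunE expr0.
rewrite normc1_eq mulr1 /coefficient.
have -> : weight ([ffun=> 0%N] : multi_index n) = 1 :> R.
  by rewrite /weight big1 ?sqrtr1 ?invr1// => i _; rewrite ffunE fact0.
by rewrite normcM normc_real normr1 mulr1 => h; have := le_trans w0 h; lra.
Qed.

End LowerBound.

Section HoleLowerBound.
Context {R : realType} {n : nat}.
Hypothesis n_ge1 : (1 <= n)%N.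

(** Exceeds the factor [128 * n%:R] in [gauge] by [n], so that [delta * gauge r = exp (- n r^2) <= 2
    ^ - n]. *)
Let K : R := 129 * n%:R.
(** Dominates both kinds of squares: [18 + pi] for the index zero, and [2 * K * r ^+ 2 + 5 + pi] for
    the others. *)
Let rate : R := 2 * K + 23 + pi.

Let n_ge1R : 1 <= n%:R :> R. Proof. by rewrite ler1n. Qed.
Let K_ge : 129 <= K. Proof. by rewrite /K ler_peMr. Qed.
Let rate_ge0 : 0 <= rate.
Proof. by have := pi_ge0 R; rewrite /rate; move: K_ge; lra. Qed.

Lemma expRN_le_inv (y : R) : 0 < y -> expR (- y) <= y^-1.
Proof.
move=> y0; rewrite expRN lef_pV2 ?posrE ?expR_gt0//.
by apply: le_trans (expR_ge1Dx y); rewrite lerDr.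
Qed.

Lemma two_le_expR1 : 2 <= expR 1 :> R.
Proof. by have := expR_ge1Dx (1 : R); lra. Qed.

(** By [exp (- y) <= 1 / y] a term of degree [m] is at most [4 * 4 ^ - m], hence at most
    [4 * 2 ^ - L * 2 ^ - m]; the margin [3] in [n + 3] yields [4 / 8]. *)
Lemma tail_mass_le (s : seq (multi_index n)) L : uniq s -> (n + 3 <= L)%N ->
  {in s, forall j, (L < total_degree j)%N} ->
  \sum_(j <- s) 2 * expR (- ((2 ^+ total_degree j) ^+ 2 / 2)) <= 2^-1 :> R.
Proof.
move=> us nL sL.
apply: (@le_trans _ _ (\sum_(j <- s) 4 * 2^-1 ^+ L * 2^-1 ^+ total_degree j)).
  rewrite big_seq [leRHS]big_seq; apply: ler_sum => j /sL Lj.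
  set m := total_degree j in Lj *.
  have y0 : 0 < (2 ^+ m) ^+ 2 / 2 :> R by rewrite divr_gt0 ?exprn_gt0.
  apply: (@le_trans _ _ (2 * ((2 ^+ m) ^+ 2 / 2)^-1)).
    by rewrite ler_wpM2l// expRN_le_inv.
  rewrite invf_div mulrA -natrM -mulrA ler_wpM2l//.
  rewrite -exprVn -exprVn expr2 -exprMn -expr2 exprMn.
  by rewrite ler_wpM2r ?exprn_ge0 ?invr_ge0// ler_wiXn2l ?invr_ge0 ?invf_le1 ?ler1n// ltnW.
rewrite -mulr_sumr; apply: (@le_trans _ _ (4 * 2^-1 ^+ L * 2 ^+ n)).
  by rewrite ler_wpM2l ?mulr_ge0 ?exprn_ge0 ?invr_ge0// sum_geometric_le.
have -> : L = (n + 3 + (L - (n + 3)))%N by lia.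
rewrite exprD exprD.
have h : 2^-1 ^+ n * 2 ^+ n = 1 :> R by rewrite -exprMn mulVf// expr1n.
have h2 : 2^-1 ^+ (L - (n + 3)) <= 1 :> R by rewrite exprn_ile1 ?invr_ge0 ?invf_le1 ?ler1n.
have -> : 4 * (2^-1 ^+ n * 2^-1 ^+ 3 * 2^-1 ^+ (L - (n + 3))) * 2 ^+ n =
   4 * 2^-1 ^+ 3 * (2^-1 ^+ n * 2 ^+ n) * 2^-1 ^+ (L - (n + 3)) :> R by ring.
rewrite h; move: h2; set x := _ ^+ (L - _); lra.
Qed.

Context {d : measure_display} {T : measurableType d} {P : probability T R}.
Context {omega : multi_index n -> T -> R[i]}.
Hypothesis omega_gaussian : forall j, standard_complex_gaussian P (omega j).
Hypothesis omega_indep : mutually_independent P omega.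
Context {r : R}.
Hypothesis r_ge1 : 1 <= r.

Let r2_ge1 : 1 <= r ^+ 2. Proof. by rewrite exprn_ege1. Qed.

Let delta := expR (- (K * r ^+ 2)).
(** Larger than [K * r ^+ 2], whence [4^-1 ^+ L <= delta]. *)
Let L := (Num.truncn (K * r ^+ 2)).+1.

(** Squares have elementary probabilities: on the first the real part is at least [2], and the
    second lies in the disc of radius [delta]. *)
Let box_of j := if j == [ffun=> 0%N] :> multi_index n then square 2 2 1
  else square 0 0 (delta / 2).

Let delta_gt0 : 0 < delta. Proof. exact: expR_gt0. Qed.
Let delta_le1 : delta <= 1.
Proof.
rewrite -expR0 ler_expR oppr_le0 mulr_ge0 ?sqr_ge0//.
by apply: le_trans K_ge.
Qed.

Let invpi_ge : expR (- pi) <= pi^-1 :> R.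
Proof. exact: expRN_le_inv (pi_gt0 R). Qed.

Let box_prob j :
  ((expR (- (rate * r ^+ 2)))%:E <= P ((@plane R \o omega j) @^-1` box_of j))%E.
Proof.
have pi0 := pi_ge0 R; have K0 := K_ge.
rewrite /box_of; case: eqP => _.
  apply: le_trans (gaussian_square_ge (K := 18) (omega_gaussian j) ltr01 _).
    rewrite expr1n mul1r lee_fin.
    apply: (@le_trans _ _ (expR (- pi) * expR (- 18))).
      rewrite -expRD ler_expR -opprD lerN2 /rate.
      have : (pi + 18) * 1 <= (2 * K + 23 + pi) * r ^+ 2 by apply: ler_pM => //; lra.
      by rewrite mulr1.
    by rewrite ler_wpM2r ?expR_ge0.
  move=> [x y] [/=]; rewrite !in_itv/= => /andP[x1 x2] /andP[y1 y2].
  by nra.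
apply: le_trans (gaussian_square_ge (K := 1) (omega_gaussian j) (divr_gt0 delta_gt0 (ltr0n R 2)) _).
  rewrite lee_fin.
  apply: (@le_trans _ _ ((delta ^+ 2 * expR (- 4)) * (expR (- pi) * expR (- 1)))).
    rewrite /delta -expRM_natl -!expRD ler_expR /rate.
    have h : (5 + pi) * 1 <= (23 + pi) * r ^+ 2 by apply: ler_pM => //; lra.
    by rewrite mulr1 in h; nra.
  apply: ler_pM; rewrite ?mulr_ge0 ?expR_ge0 ?sqr_ge0//.
    rewrite exprMn ler_wpM2l ?sqr_ge0//; apply: (le_trans (expRN_le_inv _)) => //.
    by lra.
  by rewrite ler_wpM2r ?expR_ge0.
move=> [x y] [/=]; rewrite !in_itv/= !add0r => /andP[x1 x2] /andP[y1 y2].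
by move: delta_le1; nra.
Qed.

Let C := [set t | forall j, j \in simplex L -> box_of j (plane (omega j t))].

Let measurable_box j : measurable (box_of j).
Proof. by rewrite /box_of; case: eqP => _; exact: measurable_square. Qed.

Let C_ge : ((expR (- (rate * r ^+ 2)) ^+ (L.+1 ^ n)%N)%:E <= P C)%E.
Proof.
have [_ ->] := independent_preimages omega_gaussian omega_indep (uniq_simplex L) measurable_box.
set q := expR _; have q0 : 0 <= q by exact: expR_ge0.
have q1 : q <= 1.
  by rewrite -expR0 ler_expR oppr_le0 mulr_ge0 ?sqr_ge0.
apply: (@le_trans _ _ (q ^+ size (simplex L : seq (multi_index n)))%:E).
  by rewrite lee_fin ler_wiXn2l// size_simplex_le.
elim: (simplex L) => [|j s IH]; first by rewrite big_nil expr0.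
rewrite big_cons [q ^+ _]exprS EFinM; apply: lee_pmul => //.
by rewrite lee_fin exprn_ge0.
Qed.

(** Each tail event [B j] of high degree is independent of [C], so together they remove at most half
    of the probability of [C]. *)
Lemma hole_lower_bound_at :
  ((expR (- (((K + 2) ^+ n * rate + 1) * r ^+ (2 * n + 2))))%:E <= P (hole omega r))%E.
Proof.
have r0 : 0 < r by apply: lt_le_trans r_ge1.
have [mC PCE] := independent_preimages omega_gaussian omega_indep (uniq_simplex L) measurable_box.
rewrite -/C in mC PCE.
have PCfin : P C \is a fin_num by exact: fin_num_measure.
pose pc := fine (P C); have pcE : P C = pc%:E by rewrite fineK.
have pc0 : 0 <= pc by rewrite -lee_fin -pcE.
pose B j := if (total_degree j <= L)%N then set0 else
  (@plane R \o omega j) @^-1` outside_disc (2 ^+ total_degree j).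
have mB j : measurable (B j).
  rewrite /B; case: ifP => // _; rewrite -[_ @^-1` _]setTI.
  by apply: (omega_gaussian j).1 => //; exact: measurable_outside_disc.
pose v (j : multi_index n) : R := if (total_degree j <= L)%N then 0 else
  pc * (2 * expR (- ((2 ^+ total_degree j) ^+ 2 / 2))).
have nL : (n + 3 <= L)%N.
  rewrite -(ler_nat R) natrD; apply/ltW/(le_lt_trans _ (truncnS_gt _)).
  apply: (@le_trans _ _ (K * 1)); first by rewrite mulr1 /K; move: n_ge1R; lra.
  by rewrite ler_wpM2l//; apply: le_trans K_ge.
have CB : (P (C `&` [set t | exists j, B j t]) <= (pc / 2)%:E)%E.
  apply: (countable_union_bound (v := v) mC mB).
  - by move=> j; rewrite /v; case: ifP => // _; rewrite !mulr_ge0 ?expR_ge0.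
  - move=> s us; rewrite (bigID (fun j => total_degree j <= L)%N)/= big1; last first.
      by move=> j jL; rewrite /v jL.
    rewrite add0r (eq_bigr (fun j => pc * (2 * expR (- ((2 ^+ total_degree j) ^+ 2 / 2))))).
      rewrite -mulr_sumr ler_wpM2l// -big_filter; apply: (@tail_mass_le _ L) => //.
        by rewrite filter_uniq.
      by move=> j; rewrite mem_filter -ltnNge => /andP[].
    by move=> j /negbTE jL; rewrite /v jL.
  move=> j; rewrite /B /v; case: ifPn => [_|]; first by rewrite setI0 measure0.
  rewrite -ltnNge => Lj.
  have jL : j \notin simplex L by rewrite mem_simplex -ltnNge.
  (* One family for the index [j] and the simplex, so that a single use of independence factors
     [P (C & B j)]. *)
  pose A' i := if i == j then outside_disc (2 ^+ total_degree j) else box_of i.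
  have mA' i : measurable (A' i).
    by rewrite /A'; case: eqP => // _; exact: measurable_outside_disc.
  have us : uniq (j :: simplex L) by rewrite /= jL uniq_simplex.
  have [_ PE] := independent_preimages omega_gaussian omega_indep us mA'.
  rewrite [X in P X](_ : _ = [set t | forall i, i \in j :: simplex L ->
      A' i (plane (omega i t))]); last first.
    apply/seteqP; split => t /=.
      move=> [Ct Bt] i; rewrite inE /A'; case: eqP => [->//|_ /=]; exact: Ct.
    move=> Ht; split; last by have := Ht j; rewrite inE eqxx /A' eqxx; exact.
    move=> i iL; have := Ht i; rewrite inE iL orbT /A'.
    by case: eqP => [ij|_]; [move: jL; rewrite -ij iL|exact].
  rewrite PE big_cons [X in (_ * X)%E](_ : _ = pc%:E); last first.
    rewrite -pcE PCE; apply: eq_big_seq => i iL; rewrite /A'.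
    by case: eqP => // ij; move: jL; rewrite -ij iL.
  rewrite mulrC EFinM lee_wpmul2r ?lee_fin// /A' eqxx.
  exact: gaussian_tail.
have mU : measurable [set t | exists j, B j t] by exact: measurable_exists.
have sub : C `\` [set t | exists j, B j t] `<=` hole omega r.
  move=> t [Ct nB].
  have gaugeE : expR (- (K * r ^+ 2)) * @gauge R n r = expR (- (n%:R * r ^+ 2)).
    by rewrite /gauge -expRD /K; congr expR; ring.
  have tau1 : expR (- (n%:R * r ^+ 2)) * 2 ^+ n <= 1.
    rewrite -[leRHS](expRxMexpNx_1 (n%:R * r ^+ 2)) mulrC ler_wpM2r ?expR_ge0//.
    rewrite expRM_natl; apply: lerXn2r; rewrite ?nnegrE ?expR_ge0//.
    by apply: (le_trans two_le_expR1); rewrite ler_expR.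
  apply: (hole_sufficient (L := L) (delta := delta) (tau := expR (- (n%:R * r ^+ 2)))) => //.
  - have := Ct [ffun=> 0%N]; rewrite mem_simplex /total_degree big1 => [|i _]; last by rewrite ffunE.
    rewrite /box_of eqxx => /(_ isT)[/=]; rewrite !in_itv/= => /andP[h _] _.
    by apply: (le_trans h); apply: le_trans (normRe_le _); exact: ler_norm.
  - move=> j /andP[j0 jL]; have := Ct j; rewrite mem_simplex jL => /(_ isT).
    rewrite /box_of; case: eqP => [j00|_].
      by move: j0; rewrite j00 /total_degree big1// => i _; rewrite ffunE.
    move=> [/=]; rewrite !in_itv/= !add0r => /andP[x1 x2] /andP[y1 y2].
    apply: (le_trans (normc_leD _)); rewrite !ger0_norm//.
    by move: (ltW x2) (ltW y2); lra.
  - move=> j Lj; rewrite leNgt; apply/negP => jbig; apply: nB; exists j.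
    rewrite /B leqNgt Lj/= /outside_disc /= -normc_sqr.
    by rewrite ltrXn2r ?nnegrE ?exprn_ge0 ?normc_ge0.
  - by rewrite /delta gaugeE.
  rewrite -gaugeE.
  rewrite ler_wpM2r ?expR_ge0//; apply: (@le_trans _ _ (expR (- 1) ^+ L)).
    apply: lerXn2r; rewrite ?nnegrE ?invr_ge0 ?expR_ge0//.
    by rewrite expRN lef_pV2 ?posrE ?expR_gt0// expR1_le4.
  rewrite -expRM_natl ler_expR mulrN mulr1 lerN2.
  by apply: ltW; exact: truncnS_gt.
have mD : measurable (C `\` [set t | exists j, B j t]) by exact: measurableD.
have mhole : measurable (hole omega r).
  by apply: hole_measurable => // j; exact: (omega_gaussian j).1.
apply: (@le_trans _ _ (P (C `\` [set t | exists j, B j t]))); last first.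
  by apply: le_measure; rewrite ?inE.
rewrite measureD//; last by rewrite ltey_eq PCfin.
apply: (@le_trans _ _ (pc%:E - (pc / 2)%:E)%E); last by apply: leeB => //; rewrite -pcE.
rewrite -EFinB lee_fin (_ : pc - pc / 2 = 2^-1 * pc); last by field.
have pc_ge : expR (- (rate * r ^+ 2)) ^+ (L.+1 ^ n)%N <= pc.
  by rewrite -lee_fin -pcE; exact: C_ge.
apply: (@le_trans _ _ (2^-1 * expR (- (rate * r ^+ 2)) ^+ (L.+1 ^ n)%N)); last first.
  by rewrite ler_wpM2l.
(* Replacing [1 / 2] by [exp (- 1)] produces the [+ 1] in the constant. *)
apply: (@le_trans _ _ (expR (- 1) * expR (- (rate * r ^+ 2)) ^+ (L.+1 ^ n)%N)); last first.
  rewrite ler_wpM2r ?exprn_ge0 ?expR_ge0// expRN lef_pV2 ?posrE ?expR_gt0//.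
  exact: two_le_expR1.
rewrite -expRM_natl -expRD ler_expR mulrN -opprD lerN2 [leRHS]mulrDl mul1r addrC.
apply: lerD; last by rewrite exprn_ege1.
rewrite exprD (_ : _ * rate * _ = ((K + 2) ^+ n * (r ^+ 2) ^+ n) * (rate * r ^+ 2)).
  rewrite ler_wpM2r ?mulr_ge0 ?exprn_ge0 ?(ltW r0)// natrX -exprMn.
  have K0 : 0 <= K by apply: le_trans K_ge.
  apply: lerXn2r; rewrite ?nnegrE ?(ler0n _ L.+1)//.
    by rewrite mulr_ge0 ?addr_ge0 ?exprn_ge0 ?(ltW r0).
  have -> : L.+1%:R = (Num.truncn (K * r ^+ 2))%:R + 2 :> R.
    by rewrite /L -[(Num.truncn _).+2]addn2 natrD.
  rewrite mulrDl; apply: lerD; last by rewrite ler_peMr.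
  by have := truncn_le (K * r ^+ 2); rewrite [RHS]mulr_ge0 ?exprn_ge0 ?(ltW r0).
by rewrite exprM; ring.
Qed.

End HoleLowerBound.

(** * Upper bound *)

Section SimplexOrder.
Context {n : nat}.
Implicit Types (i j : multi_index n).

(** In the successive confinement by cells, all lower degrees are thus settled before [j], as
    [coef_gap] requires. *)
Lemma simplex_prefix M s1 j s2 i : simplex M = s1 ++ j :: s2 ->
  (total_degree i < total_degree j)%N -> i \in s1.
Proof.
move=> E ij; pose le_degree (i j : multi_index n) := (total_degree i <= total_degree j)%N.
have sorted_simplex : pairwise le_degree (simplex M).
  elim: M {E} => [|M IH].
    by apply/(pairwiseP [ffun=> 0%N]) => k l; rewrite !inE => kM lM _;
      have := mem_nth [ffun=> 0%N] kM; rewrite mem_simplex leqn0 /le_degree => /eqP ->.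
  rewrite simplexS pairwise_cat IH; apply/andP; split.
    apply/allrelP => x y; rewrite mem_simplex mem_homog => xM /eqP yM.
    by rewrite /le_degree yM ltnW.
  apply/(pairwiseP [ffun=> 0%N]) => k l; rewrite !inE => kM lM _.
  have := mem_nth [ffun=> 0%N] kM; have := mem_nth [ffun=> 0%N] lM.
  by rewrite !mem_homog /le_degree => /eqP -> /eqP ->.
have jM : j \in simplex M by rewrite E mem_cat inE eqxx orbT.
have : i \in simplex M.
  by move: jM; rewrite !mem_simplex; apply: leq_trans; exact: ltnW.
rewrite E mem_cat inE => /orP[//|/predU1P[ij'|is2]].
  by move: ij; rewrite ij' ltnn.
move: sorted_simplex; rewrite E pairwise_cat => /and3P[_ _] /= /andP[/allP/(_ i is2)].
by rewrite /le_degree leqNgt ij.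
Qed.

(** Shifting the box by [h] in every coordinate gives [h.+1 ^ n] indices with degrees between
    [n * h] and [2 * n * h]. *)
Lemma sum_degree_ge M h : (0 < n)%N -> (2 * h * n <= M)%N ->
  (h * h.+1 ^ n <= \sum_(j <- simplex M : seq (multi_index n)) total_degree j)%N.
Proof.
move=> n0 hM; pose shift (j : multi_index n) : multi_index n := [ffun i => (j i + h)%N].
have shift_inj : injective shift.
  by move=> i j /ffunP E; apply/ffunP => k; have := E k; rewrite !ffunE => /addIn.
have shift_degree j : total_degree (shift j) = (total_degree j + n * h)%N.
  rewrite /total_degree; under eq_bigr do rewrite ffunE.
  by rewrite big_split/= sum_nat_const card_ord.
have sub : {subset map shift (box h) <= simplex M}.
  move=> _ /mapP[j jh ->]; rewrite mem_simplex shift_degree.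
  apply: leq_trans hM; have -> : (2 * h * n = n * h + n * h)%N by lia.
  rewrite leq_add2r.
  rewrite /total_degree; apply: (@leq_trans (\sum_(i < n) h)).
    by apply: leq_sum => i _; move: jh; rewrite mem_box => /forallP.
  by rewrite sum_nat_const card_ord.
have us : uniq (map shift (box h)) by rewrite map_inj_uniq ?uniq_box.
apply: (@leq_trans (\sum_(j <- map shift (box h)) total_degree j)).
  rewrite big_map -size_box -[X in (X <= _)%N]mulnC -sum1_size big_distrl/=.
  apply: leq_sum => j _; rewrite mul1n shift_degree.
  by apply: leq_trans (leq_addl _ _); rewrite leq_pmull.
rewrite [X in (_ <= X)%N](bigID (mem (map shift (box h))))/=.
apply: leq_trans (leq_addr _ _); rewrite -[X in (_ <= X)%N]big_filter.
apply: eq_leq; apply: perm_big; apply: uniq_perm; rewrite ?filter_uniq ?uniq_simplex//.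
by move=> j; rewrite mem_filter andb_idr//; exact: sub.
Qed.

End SimplexOrder.

Section Asymptotics.
Context {R : realType}.

(** The term of order [k.+1] in the exponential series grows like [r ^ (2 k + 2)]. *)
Lemma power_le_expR_sqr (C eps : R) k : 0 < eps ->
  exists2 R0 : R, 0 <= R0 & forall r, R0 < r -> 1 <= r -> C * r ^+ k <= expR (eps * r ^+ 2).
Proof.
move=> e0; exists (`|C| * k.+1`!%:R / eps ^+ k.+1).
  by rewrite divr_ge0 ?mulr_ge0 ?exprn_ge0 ?(ltW e0).
move=> r rR r1; have r0 : 0 <= r by apply: le_trans r1.
have := @expr_le_expR R (eps * r ^+ 2) k.+1 (mulr_ge0 (ltW e0) (sqr_ge0 r)).
rewrite -ler_pdivrMl ?ltr0n ?fact_gt0//; apply: le_trans.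
apply: (@le_trans _ _ (`|C| * r ^+ k)); first by rewrite ler_wpM2r ?exprn_ge0// ler_norm.
rewrite ler_pdivlMl ?ltr0n ?fact_gt0// exprMn.
move/ltW: rR; rewrite ler_pdivrMr ?exprn_gt0// => rR.
have -> : (r ^+ 2) ^+ k.+1 = r ^+ k.+1 * (r * r ^+ k).
  by rewrite -exprS -exprMn -expr2.
rewrite !mulrA ler_wpM2r ?exprn_ge0// mulrC.
apply: (le_trans rR); rewrite mulrC -mulrA ler_wpM2l ?exprn_ge0 ?(ltW e0)//.
by rewrite ler_peMl// exprn_ege1.
Qed.

End Asymptotics.

(** * Outcomes with controlled coefficients *)

Section GoodEvent.
Context {R : realType} {n : nat} {d : measure_display} {T : measurableType d}.
Context {omega : multi_index n -> T -> R[i]}.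

Local Notation coef := (coefficient (omega := omega)).
Local Notation zero_index := ([ffun=> 0%N] : multi_index n).

Lemma coefficient0 t : coef t zero_index = omega zero_index t.
Proof.
rewrite /coefficient /weight big1 => [|i _]; last by rewrite ffunE fact0.
by rewrite sqrtr1 invr1 mulr1.
Qed.

Lemma normc_coefficient t j : normc (coef t j) = normc (omega j t) * weight j.
Proof. by rewrite normcM normc_real ger0_norm// ltW// weight_gt0. Qed.

Definition good (u b : R) t := (forall j, normc (omega j t) <= u * 2 ^+ total_degree j) /\
  b <= normc (omega zero_index t).

(** Of the factor [4] in the radius [4 * x], one [2] absorbs the growth of [omega j] and the other
    leaves a summable geometric weight; [8 = 4 ^ 2 / 2]. *)
Lemma good_sum_le (u b x : R) t (s : seq (multi_index n)) : 0 <= u -> 0 <= x ->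
  good u b t -> uniq s ->
  \sum_(j <- s) normc (coef t j) * x ^+ total_degree j <= u * (2 ^+ n * expR (8 * n%:R * x ^+ 2)).
Proof.
move=> u0 x0 [omega_le _] us.
apply: (@le_trans _ _ (\sum_(j <- s) u * expR (8 * n%:R * x ^+ 2) * 2^-1 ^+ total_degree j)).
  apply: ler_sum => j _; rewrite normc_coefficient.
  have h := @expr_weight_le R n (4 * x) j (mulr_ge0 (ler0n _ 4) x0).
  apply: (@le_trans _ _ (u * 2 ^+ total_degree j * weight j * x ^+ total_degree j)).
    by rewrite !ler_wpM2r ?exprn_ge0// ltW// weight_gt0.
  have -> : u * 2 ^+ total_degree j * weight j * x ^+ total_degree j =
      u * 2^-1 ^+ total_degree j * ((4 * x) ^+ total_degree j * weight j).
    have -> : 4 * x = (2 * 2) * x by rewrite -natrM.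
    rewrite !exprMn.
    have h2 : 2^-1 ^+ total_degree j * 2 ^+ total_degree j = 1 :> R.
      by rewrite -exprMn mulVf// expr1n.
    transitivity (u * (2^-1 ^+ total_degree j * 2 ^+ total_degree j) * 2 ^+ total_degree j *
      weight j * x ^+ total_degree j); [by rewrite h2 mulr1|ring].
  rewrite [leRHS]mulrAC ler_wpM2l ?mulr_ge0 ?exprn_ge0 ?invr_ge0//; apply: (le_trans h).
  rewrite ler_expR exprMn.
  by rewrite le_eqVlt; apply/orP; left; apply/eqP; field.
rewrite -mulr_sumr -mulrA ler_wpM2l// mulrC ler_wpM2r ?expR_ge0//.
exact: sum_geometric_le.
Qed.

Lemma good_converges (u b rho : R) t : 0 <= u -> 0 <= rho -> good u b t ->
  converges_on (coef t) (fun=> rho).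
Proof.
move=> u0 rho0 gt; exists (u * (2 ^+ n * expR (8 * n%:R * rho ^+ 2))) => s us.
apply: le_trans (good_sum_le u0 rho0 gt us); apply: ler_sum => j _.
by rewrite /monomial prod_exp_degree.
Qed.

Lemma good_growth (u b rho D : R) t : 0 <= u -> 0 < rho -> good u b t ->
  (forall q, u * (2 ^+ n * expR (8 * n%:R * (5 * (2 ^+ q.+1 * rho)) ^+ 2)) <=
     b * expR (D * 4 ^+ q.+1)) ->
  order_two_growth (coef t) rho D.
Proof.
move=> u0 rho0 gt hD N z q zq; rewrite coefficient0.
apply: (@le_trans _ _ (b * expR (D * 4 ^+ q.+1))); last first.
  by rewrite ler_wpM2r ?expR_ge0//; case: gt.
apply: le_trans (hD q).
have x0 : 0 <= 5 * (2 ^+ q.+1 * rho) by rewrite !mulr_ge0 ?exprn_ge0 ?(ltW rho0).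
apply: le_trans (good_sum_le u0 x0 gt (uniq_simplex N)).
apply: (le_trans (ler_normc_sum _ _ _)); apply: ler_sum => j _.
by rewrite [leLHS]normcM ler_wpM2l ?normc_ge0// normc_monomial_le.
Qed.

Lemma hole_zero_free (u b r rho : R) t : 0 <= u -> 0 <= rho -> 0 < r ->
  n%:R * rho ^+ 2 < r ^+ 2 -> good u b t -> hole omega r t ->
  zero_free (coef t) rho.
Proof.
move=> u0 rho0 r0 rho_r gt ht.
apply: power_series_zero_free => // [|z zrho]; first exact: good_converges gt.
have := ht (\row_i z i); rewrite psiE in_ball//.
have -> : (fun i => (\row_i z i) 0 i) = z by apply/funext => i; rewrite mxE.
apply; apply: le_lt_trans rho_r.
apply: (@le_trans _ _ (\sum_(i < n) rho ^+ 2)).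
  by apply: ler_sum => i _; rewrite mxE lerXn2r ?nnegrE ?normc_ge0.
by rewrite sumr_const card_ord mulr_natl.
Qed.

(** From [j_i! <= M ^ j_i]. Dividing a coefficient bound of order [rho ^ - m] by the weight then
    leaves [4 ^ - m], which is the role of the restriction to degrees at most [M]. *)
Lemma weight_ge (rho : R) M (j : multi_index n) : 0 < rho -> 16 * M%:R <= rho ^+ 2 ->
  (total_degree j <= M)%N -> (4 / rho) ^+ total_degree j <= weight j :> R.
Proof.
move=> rho0 Mrho jM.
have fact_le m : (m <= M)%N -> (m`! <= M ^ m)%N.
  elim: m => [//|m IH mM]; rewrite factS expnS.
  by apply: leq_mul => //; apply: IH; exact: ltnW.
rewrite -ler_sqr ?nnegrE ?exprn_ge0 ?divr_ge0 ?(ltW rho0) ?(ltW (weight_gt0 j))//.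
rewrite /weight exprVn sqr_sqrtr; last by apply: prodr_ge0.
rewrite -natr_prod.
rewrite -[leLHS]invrK lef_pV2 ?posrE ?invr_gt0 ?exprn_gt0 ?divr_gt0//; last first.
  by rewrite ltr0n prodn_gt0// => i; rewrite fact_gt0.
apply: (@le_trans _ _ (M%:R ^+ total_degree j)).
  rewrite -prod_exp_degree natr_prod; apply: ler_prod => i _.
  rewrite ler0n -natrX ler_nat fact_le//.
  exact: leq_trans (index_le_degree j i) jM.
rewrite -exprM mulnC exprM -exprVn lerXn2r ?nnegrE ?invr_ge0 ?sqr_ge0//.
rewrite exprMn exprVn invfM invrK mulrC ler_pdivlMr ?exprn_gt0// mulrC.
by apply: le_trans Mrho; rewrite ler_wpM2r// expr2 -natrM.
Qed.

End GoodEvent.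

Section HoleCover.
Context {R : realType} {n : nat} {d : measure_display} {T : measurableType d}.
Context {P : probability T R} {omega : multi_index n -> T -> R[i]}.
Hypothesis omega_gaussian : forall j, standard_complex_gaussian P (omega j).
Hypothesis omega_indep : mutually_independent P omega.

(* Degrees at most [2], for which [coef_gap] is void, are confined by the bound on
   the coefficients itself. *)
Lemma hole_good_cover (u b r rho D : R) M : 0 < u -> 0 < b -> 0 < r -> 1 <= rho ->
  16 * M%:R <= rho ^+ 2 -> n%:R * rho ^+ 2 < r ^+ 2 -> 8 <= D ->
  (forall q, u * (2 ^+ n * expR (8 * n%:R * (5 * (2 ^+ q.+1 * rho)) ^+ 2)) <=
     b * expR (D * 4 ^+ q.+1)) ->
  exists B, [/\ measurable B,
    hole omega r `&` [set t | good (omega := omega) u b t /\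
      normc (omega [ffun=> 0%N] t) <= u] `<=` B &
    (P B <= (\prod_(j <- simplex M : seq (multi_index n))
       (4 * (2 * (u * (8 * D + 2)) * 4^-1 ^+ total_degree j)) ^+ 2)%:E)%E].
Proof.
move=> u0 b0 r0 rho1 Mrho rho_r D8 growth.
have rho0 : 0 < rho by apply: lt_le_trans rho1.
set U := 2 * (u * (8 * D + 2)).
(* In degree at most [2] the trivial bound [8 * u] must not exceed [U / 16]. *)
have U128 : 128 * u <= U by rewrite /U; nra.
have U0 : 0 < U by apply: lt_le_trans U128; rewrite mulr_gt0.
have V0 : 0 <= u * 2 ^+ M by rewrite mulr_ge0 ?exprn_ge0 ?(ltW u0).
(* An error of this size merely raises [8 * D + 1] to [8 * D + 2] in every degree up to [M]. *)
have tau0 : 0 < 2 * u / rho ^+ M by rewrite divr_gt0 ?mulr_gt0 ?exprn_gt0.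
have [eta0 eta00 gap] := @coef_gap R n b u _ rho D _ M b0 rho0 V0 tau0.
pose S (j : multi_index n) := if (total_degree j <= M)%N
  then U * 4^-1 ^+ total_degree j else U.
(* Points of one cell are within [2 * eta], hence [eta0 / 2]; the second bound keeps [eta] below
   every [S j]. *)
pose eta := Num.min (eta0 / 2) (U * 4^-1 ^+ M).
have etapos : 0 < eta.
  by rewrite lt_min divr_gt0//= mulr_gt0 ?exprn_gt0 ?invr_gt0.
have quarter_le k l : (k <= l)%N -> (4^-1 : R) ^+ l <= 4^-1 ^+ k.
  by move=> kl; rewrite ler_wiXn2l ?invr_ge0 ?invf_le1 ?ler1n.
have etaS j : eta <= S j.
  apply: (@le_trans _ _ (U * 4^-1 ^+ M)); first by rewrite ge_min lexx orbT.
  rewrite /S; case: ifP => [jM|_]; first by rewrite ler_wpM2l ?(ltW U0) ?quarter_le.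
  by rewrite ler_piMr ?(ltW U0)// exprn_ile1 ?invr_ge0 ?invf_le1 ?ler1n.
pose E := hole omega r `&` [set t | good (omega := omega) u b t /\
      normc (omega [ffun=> 0%N] t) <= u].
have Eadm t : E t -> [/\ zero_free (coefficient (omega := omega) t) rho,
    order_two_growth (coefficient (omega := omega) t) rho D,
    b <= normc (coefficient (omega := omega) t [ffun=> 0%N]) <= u &
    forall j, (total_degree j <= M)%N ->
      normc (coefficient (omega := omega) t j) <= u * 2 ^+ M].
  move=> [ht [gt tu]]; split.
  - exact: hole_zero_free (ltW u0) (ltW rho0) r0 rho_r gt ht.
  - exact: good_growth (ltW u0) rho0 gt growth.
  - by rewrite coefficient0 tu andbT; case: gt.
  move=> j jM; rewrite normc_coefficient.
  apply: (@le_trans _ _ (normc (omega j t))).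
    by rewrite ler_piMr ?normc_ge0 ?weight_le1.
  apply: (le_trans (gt.1 j)); rewrite ler_wpM2l ?(ltW u0)//.
  by rewrite ler_weXn2l// ler1n.
suff confined : forall s1 j s2 t t', simplex M = s1 ++ j :: s2 -> E t -> E t' ->
    (forall k, k \in s1 -> normc (omega k t - omega k t') <= 2 * eta) ->
    normc (omega j t - omega j t') <= S j.
  have [B [mB EB PB]] :=
    cell_cover omega_gaussian omega_indep etapos (uniq_simplex M) etaS confined.
  exists B; split=> //; apply: (le_trans PB); rewrite lee_fin.
  rewrite le_eqVlt; apply/orP; left; apply/eqP; apply: eq_big_seq => j.
  by rewrite mem_simplex /S => ->.
move=> s1 j s2 t t' sE Et Et' close.
have jM : (total_degree j <= M)%N by rewrite -mem_simplex sE mem_cat inE eqxx orbT.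
rewrite /S jM; have [j3|j3] := leqP 3 (total_degree j); last first.
  have omega_small v : E v -> normc (omega j v) <= 4 * u.
    move=> [_ [gv _]]; apply: (le_trans (gv.1 j)); rewrite mulrC ler_wpM2r ?(ltW u0)//.
    have -> : 4 = 2 ^+ 2 :> R by rewrite -natrX.
    by rewrite ler_weXn2l ?ler1n.
  apply: (le_trans (ler_normcB _ _)); apply: (@le_trans _ _ (8 * u)).
    by have := omega_small _ Et; have := omega_small _ Et'; lra.
  apply: (@le_trans _ _ (U * 4^-1 ^+ 2)); last by rewrite ler_wpM2l ?(ltW U0) ?quarter_le.
  by rewrite expr2; move: U128; lra.
have w0 := @weight_gt0 R n j.
have coefB k v v' : coefficient (omega := omega) v k - coefficient (omega := omega) v' k =
    (omega k v - omega k v') * (weight k)%:C by rewrite /coefficient mulrBl.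
have normcw k : normc ((weight k)%:C : R[i]) = weight k.
  by rewrite normc_real ger0_norm// ltW// weight_gt0.
have := gap (coefficient (omega := omega) t) (coefficient (omega := omega) t') _
  (total_degree j) _ _ j erefl.
rewrite coefB normcM normcw -ler_pdivlMr// => h.
apply: le_trans (h _ _ _) _.
- by move=> f [->|->]; exact: Eadm.
- by rewrite j3.
- move=> k kj; rewrite coefB normcM normcw.
  apply: (@le_trans _ _ (normc (omega k t - omega k t'))).
    by rewrite ler_piMr ?normc_ge0 ?weight_le1.
  apply: (le_trans (close k (simplex_prefix sE kj))).
  by rewrite mulrC -ler_pdivlMr// ge_min lexx.
rewrite ler_pdivrMr//; set m := total_degree j in jM j3 *.
have wge := @weight_ge R n rho M j rho0 Mrho jM.
apply: (@le_trans _ _ (U * 4^-1 ^+ m * (4 / rho) ^+ m)); last first.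
  apply: ler_wpM2l; last exact: wge.
  by rewrite mulr_ge0 ?exprn_ge0 ?invr_ge0 ?(ltW U0).
have -> : U * 4^-1 ^+ m * (4 / rho) ^+ m = U / rho ^+ m.
  by rewrite -mulrA -exprMn mulrA mulVf// mul1r exprVn.
have rhoM : (rho ^+ M)^-1 <= (rho ^+ m)^-1.
  by rewrite lef_pV2 ?posrE ?exprn_gt0// ler_weXn2l.
apply: (@le_trans _ _ (2 * (u * ((8 * D + 1) / rho ^+ m)) + 2 * u / rho ^+ m)).
  by rewrite lerD2l ler_wpM2l ?mulr_ge0 ?(ltW u0).
by rewrite /U le_eqVlt; apply/orP; left; apply/eqP; ring.
Qed.

End HoleCover.

Lemma exp2_sqr (R : realType) m : (2 ^+ m) ^+ 2 = 4 ^+ m :> R.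
Proof. by rewrite -exprM mulnC exprM; congr (_ ^+ _); rewrite expr2 -natrM. Qed.

Section BadEvents.
Context {R : realType} {n : nat} {d : measure_display} {T : measurableType d}.
Context {P : probability T R} {omega : multi_index n -> T -> R[i]}.
Hypothesis omega_gaussian : forall j, standard_complex_gaussian P (omega j).

Lemma measurable_preimage_plane j A : measurable A -> measurable ((@plane R \o omega j) @^-1` A).
Proof. by move=> mA; rewrite -[_ @^-1` _]setTI; apply: (omega_gaussian j).1. Qed.

Lemma large_coefficient_prob (u : R) : 1 <= u ->
  (P [set t | exists j, ((@plane R \o omega j) @^-1` outside_disc (u * 2 ^+ total_degree j)) t]
    <= (2 ^+ (n + 3) * expR (- (u ^+ 2 / 4)))%:E)%E.
Proof.
move=> u1; pose v (j : multi_index n) : R := 2 * expR (- ((u * 2 ^+ total_degree j) ^+ 2 / 2)).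
have u2 : 1 <= u ^+ 2 by rewrite exprn_ege1.
rewrite -[X in P X]setTI; apply: (countable_union_bound (v := v)) => //.
- by move=> j; apply: measurable_preimage_plane; exact: measurable_outside_disc.
- by move=> j; rewrite /v mulr_ge0 ?expR_ge0.
- move=> s us; apply: (@le_trans _ _ (\sum_(j <- s) 8 * expR (- (u ^+ 2 / 4)) * 2^-1 ^+ total_degree j)).
    apply: ler_sum => j _; rewrite /v; set m := total_degree j.
    have y1 : 1 <= (4 : R) ^+ m by rewrite exprn_ege1// ler1n.
    have -> : (u * 2 ^+ m) ^+ 2 = u ^+ 2 * 4 ^+ m.
      by rewrite exprMn exp2_sqr.
    (* For [x, y >= 1] one has [x * y / 2 >= x / 4 + y / 4], which separates [u] from the degree. *)
    apply: (@le_trans _ _ (2 * (expR (- (u ^+ 2 / 4)) * expR (- (4 ^+ m / 4))))).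
      by rewrite ler_wpM2l// -expRD ler_expR; move: y1 u2; set y := 4 ^+ m; set x := u ^+ 2; nra.
    have -> : 8 * expR (- (u ^+ 2 / 4)) * 2^-1 ^+ m = 2 * (expR (- (u ^+ 2 / 4)) * (4 * 2^-1 ^+ m)) by ring.
    rewrite !ler_wpM2l ?expR_ge0//.
    apply: (le_trans (expRN_le_inv _)); first by rewrite divr_gt0 ?exprn_gt0.
    rewrite invf_div ler_wpM2l// exprVn lef_pV2 ?posrE ?exprn_gt0//.
    by rewrite lerXn2r ?nnegrE// ler_nat.
  rewrite -mulr_sumr; apply: (@le_trans _ _ (8 * expR (- (u ^+ 2 / 4)) * 2 ^+ n)).
    by rewrite ler_wpM2l ?mulr_ge0 ?expR_ge0// sum_geometric_le.
  by rewrite exprD le_eqVlt; apply/orP; left; apply/eqP; ring.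
move=> j; rewrite setTI; exact: gaussian_tail.
Qed.

Lemma small_coefficient_prob (b : R) j : 0 < b ->
  exists A, [/\ measurable A, [set t | normc (omega j t) < b] `<=` A &
    (P A <= (4 * b ^+ 2)%:E)%E].
Proof.
move=> b0; exists ((@plane R \o omega j) @^-1` square (- b) (- b) (2 * b)); split.
- by apply: measurable_preimage_plane; exact: measurable_square.
- move=> t /= tb; have := le_lt_trans (normRe_le _) tb; have := le_lt_trans (normIm_le _) tb.
  rewrite !ltr_norml => /andP[h1 h2] /andP[h3 h4].
  by split; rewrite /= in_itv/=; apply/andP; split; move: h1 h2 h3 h4; lra.
apply: (le_trans (gaussian_square_le _ _ (omega_gaussian j) (mulr_gt0 (ltr0n R 2) b0))).
by rewrite lee_fin exprMn [2 ^+ 2]expr2 -natrM.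
Qed.

End BadEvents.

Section HoleUpperBound.
Context {R : realType} {n : nat}.
Hypothesis n_ge1 : (1 <= n)%N.

(* With [M] about [(r / (2 * n)) ^+ 2 / 16], the [(h + 1) ^ n] multi-indices with
   entries between [h] and [2 * h], [h = M / (2 * n) >= a * r ^+ 2], give the
   degrees in [simplex M] the total at least [kappa * r ^+ (2 * n + 2)]. *)
Let a : R := (256 * n%:R ^+ 3)^-1.
Let kappa : R := a ^+ n.+1.
(** Each index loses [3 * eps * r ^+ 2] in the exponent, in all at most
    [kappa / 2 * r ^+ (2 * n + 2)], half of the gain from the degrees. *)
Let eps : R := kappa / 6.
Let n_ge1R : 1 <= n%:R :> R. Proof. by rewrite ler1n. Qed.
Let n3_ge1 : 1 <= n%:R ^+ 3 :> R. Proof. by rewrite exprn_ege1. Qed.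
Let a_gt0 : 0 < a. Proof. by rewrite invr_gt0; move: n3_ge1; lra. Qed.
Let a_le1 : a <= 1. Proof. by rewrite invf_le1; move: n3_ge1; lra. Qed.
Let kappa_gt0 : 0 < kappa. Proof. by rewrite exprn_gt0. Qed.
Let kappa_le1 : kappa <= 1. Proof. by rewrite exprn_ile1// ltW. Qed.
Let eps_gt0 : 0 < eps. Proof. by rewrite divr_gt0. Qed.
Let C1 : R := 8 * (8 * (52 + n%:R) + 2).

Lemma hole_upper_bound_at (r : R) :
  1 <= r -> 2 * n%:R <= r -> 1 / a <= r -> 4 / kappa <= r ->
  2 * (2 ^+ (n + 3) + 4) <= r ->
  C1 ^+ 2 * r ^+ (4 * n + 4) <= expR (eps * r ^+ 2) ->
  8 * r ^+ (2 * n + 2) <= expR (eps * r ^+ 2) ->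
  forall (d : measure_display) (T : measurableType d) (P : probability T R)
    (omega : multi_index n -> T -> R[i]),
  (forall j, standard_complex_gaussian P (omega j)) ->
  mutually_independent P omega ->
  (P (hole omega r) <= (expR (- (kappa / 4 * r ^+ (2 * n + 2))))%:E)%E.
Proof.
move=> r1 rn ra rk rS rC r8 d T P omega og oi.
have r0 : 0 < r by apply: lt_le_trans r1.
pose W := r ^+ (2 * n + 2).
have WE : W = (r ^+ 2) ^+ n.+1 by rewrite /W -exprM mulnS addnC.
have r2_ge_r : r <= r ^+ 2 by rewrite expr2 ler_peMr ?(ltW r0).
have W_ge_r2 : r ^+ 2 <= W by rewrite WE [_ ^+ n.+1]exprS ler_peMr ?exprn_ege1// exprn_ge0 ?ltW.
have W1 : 1 <= W by rewrite exprn_ege1.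
have nR0 : 0 < n%:R :> R by rewrite ltr0n.
(* Small enough for the polydisc to lie in the ball: [n * rho ^ 2 = r ^ 2 / (4 * n)]. *)
pose rho := r / (2 * n%:R).
have n2_gt0 : 0 < 2 * n%:R :> R by move: n_ge1R; lra.
have rho1 : 1 <= rho by rewrite ler_pdivlMr// mul1r.
have rho2E : rho ^+ 2 = r ^+ 2 / (4 * n%:R ^+ 2) by rewrite /rho exprMn exprVn exprMn [2 ^+ 2]expr2 -natrM.
pose M := Num.truncn (rho ^+ 2 / 16).
have M_le : 16 * M%:R <= rho ^+ 2.
  have := truncn_le (rho ^+ 2 / 16); rewrite [RHS]divr_ge0 ?sqr_ge0//.
  by rewrite ler_pdivlMr// mulrC.
have rho_le_r : rho ^+ 2 <= r ^+ 2 / 4.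
  rewrite rho2E ler_wpM2l ?sqr_ge0// lef_pV2 ?posrE ?mulr_gt0 ?exprn_gt0//.
  by rewrite ler_peMr// exprn_ege1.
have rho_r : n%:R * rho ^+ 2 < r ^+ 2.
  have -> : n%:R * rho ^+ 2 = r ^+ 2 / (4 * n%:R).
    by rewrite rho2E; field; rewrite pnatr_eq0 -lt0n.
  rewrite ltr_pdivrMr ?mulr_gt0// ltr_pMr ?exprn_gt0//.
  by move: n_ge1R; lra.
have M_le_r2 : M.+1%:R <= r ^+ 2.
  rewrite -addn1 natrD; move: M_le rho_le_r n_ge1R rn r2_ge_r.
  by set x := r ^+ 2; set y := rho ^+ 2; lra.
(* In the growth condition, [50] comes from [8 * n * 25 * rho ^ 2 = 50 / n * r ^ 2], one [1] each
   from [u] and [b], and [n] from [2 ^+ n]. *)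
pose D := (52 + n%:R) * W.
have D8 : 8 <= D by rewrite /D; move: n_ge1R W1; nra.
(* The tail [exp (- u ^ 2 / 4)] is doubly exponentially small in [r ^ 2]. *)
pose u := expR (eps * r ^+ 2).
have u1 : 1 <= u by rewrite -expR0 ler_expR mulr_ge0 ?sqr_ge0 ?(ltW eps_gt0).
pose b := expR (- W).
have growth q : u * (2 ^+ n * expR (8 * n%:R * (5 * (2 ^+ q.+1 * rho)) ^+ 2)) <=
    b * expR (D * 4 ^+ q.+1).
  have two_n : 2 ^+ n <= expR n%:R :> R.
    rewrite -[X in expR X]mulr1 expRM_natl; apply: lerXn2r; rewrite ?nnegrE ?expR_ge0//.
    exact: two_le_expR1.
  apply: (@le_trans _ _ (u * (expR n%:R * expR (8 * n%:R * (5 * (2 ^+ q.+1 * rho)) ^+ 2)))).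
    by rewrite ler_wpM2l ?expR_ge0// ler_wpM2r ?expR_ge0.
  rewrite /u /b -!expRD ler_expR.
  set Y : R := 4 ^+ q.+1.
  have Y1 : 1 <= Y by rewrite exprn_ege1// ler1n.
  have -> : (5 * (2 ^+ q.+1 * rho)) ^+ 2 = 25 * (Y * rho ^+ 2).
    by rewrite exprMn exprMn exp2_sqr -/Y; congr (_ * _); rewrite expr2 -natrM.
  have -> : 8 * n%:R * (25 * (Y * rho ^+ 2)) = 50 / n%:R * (Y * r ^+ 2).
    by rewrite rho2E; field; rewrite pnatr_eq0 -lt0n.
  have fifty : 50 / n%:R * (Y * r ^+ 2) <= 50 * (Y * W).
    apply: ler_pM; first by rewrite divr_ge0// ltW.
    - by rewrite mulr_ge0 ?sqr_ge0// (le_trans _ Y1).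
    - by rewrite ler_pdivrMr// ler_peMr.
    - by rewrite ler_wpM2l// (le_trans _ Y1).
  have er : eps * r ^+ 2 <= W.
    apply: le_trans W_ge_r2; rewrite ler_piMl ?sqr_ge0// /eps.
    by move: kappa_le1; lra.
  have WY : W <= Y * W by rewrite ler_peMl// (le_trans _ W1).
  have nWY : n%:R <= n%:R * (Y * W) by rewrite ler_peMr// (le_trans W1).
  rewrite /D (_ : (52 + n%:R) * W * Y = 52 * (Y * W) + n%:R * (Y * W)); last by ring.
  by move: fifty er WY nWY; lra.
have product_le : \prod_(j <- simplex M : seq (multi_index n))
    (4 * (2 * (u * (8 * D + 2)) * 4^-1 ^+ total_degree j)) ^+ 2 <= expR (- (kappa / 2 * W)).
  (* Two of the three [eps * r ^+ 2] are [u ^+ 2]; the third absorbs the square of the polynomial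
     factor in [D]. *)
  pose G := expR (3 * eps * r ^+ 2).
  have U_le : (8 * (u * (8 * D + 2))) ^+ 2 <= G.
    have D_le : 8 * (8 * D + 2) <= C1 * W.
      by rewrite /C1 /D; move: W1; set w := W; set x := n%:R; nra.
    have D0 : 0 <= 8 * D + 2 by move: D8; lra.
    rewrite mulrCA exprMn /u -expRM_natl.
    have -> : G = expR (2 * (eps * r ^+ 2)) * expR (eps * r ^+ 2).
      by rewrite /G -expRD; congr expR; ring.
    rewrite ler_wpM2l ?expR_ge0//; apply: le_trans rC.
    apply: (@le_trans _ _ ((C1 * W) ^+ 2)).
      by apply: lerXn2r; rewrite ?nnegrE//; [rewrite mulr_ge0|apply: le_trans D_le; rewrite mulr_ge0].
    by rewrite exprMn /W -exprM [(_ * 2)%N]mulnDl mulnAC.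
  (* Of the gain [16 ^ - m] in degree [m] only [exp (- m)] is kept. *)
  apply: (@le_trans _ _ (\prod_(j <- simplex M : seq (multi_index n))
      (G * expR (- 1) ^+ total_degree j))).
    apply: ler_prod => j _; rewrite sqr_ge0/=; set m := total_degree j.
    rewrite [X in X ^+ 2](_ : _ = 8 * (u * (8 * D + 2)) * 4^-1 ^+ m); last by ring.
    rewrite exprMn; apply: ler_pM; rewrite ?sqr_ge0//.
    have q0 : 0 <= (4^-1 : R) ^+ m by rewrite exprn_ge0 ?invr_ge0.
    apply: (@le_trans _ _ (4^-1 ^+ m)).
      by rewrite expr2 ler_piMl// exprn_ile1 ?invr_ge0 ?invf_le1 ?ler1n.
    apply: lerXn2r; rewrite ?nnegrE ?invr_ge0 ?expR_ge0//.
    by rewrite expRN lef_pV2 ?posrE ?expR_gt0// expR1_le4.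
  rewrite big_split/= prodrXr big_const_seq count_predT iter_mulr_1.
  set N := size _; set Sigma := (\sum_(j <- _) _)%N.
  pose h := (M %/ (2 * n))%N.
  have Sigma_ge : (h * h.+1 ^ n <= Sigma)%N.
    by apply: sum_degree_ge => //; rewrite mulnAC mulnC; exact: leq_trunc_div.
  (* [rho ^ 2 / 16] divided by [2 * n] is [r ^ 2 / (128 * n ^ 3)], twice [a * r ^ 2]; the factor [2]
     pays for passing from [h.+1] to [h]. *)
  have h1_ge : 2 * (a * r ^+ 2) <= h.+1%:R.
    have h1 : rho ^+ 2 / 16 < h.+1%:R * (2 * n%:R).
      apply: (lt_le_trans (truncnS_gt _)); rewrite -!natrM ler_nat.
      by apply: ltn_ceil; rewrite muln_gt0.
    move: h1; rewrite -ltr_pdivrMr// => /ltW; apply: le_trans.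
    rewrite rho2E le_eqVlt; apply/orP; left; apply/eqP; rewrite /a.
    by field; rewrite pnatr_eq0 -lt0n.
  have ar1 : 1 <= a * r ^+ 2.
    by rewrite -ler_pdivrMl// mulrC; apply: le_trans r2_ge_r.
  have h_ge : a * r ^+ 2 <= h%:R by move: h1_ge; rewrite -addn1 natrD; move: ar1; lra.
  have Sigma_geR : kappa * W <= Sigma%:R.
    apply: (@le_trans _ _ (h * h.+1 ^ n)%N%:R); last by rewrite ler_nat.
    rewrite natrM natrX WE /kappa -exprMn exprS.
    apply: ler_pM; rewrite ?exprn_ge0 ?(le_trans ler01 ar1)//.
    by apply: lerXn2r; rewrite ?nnegrE ?(le_trans ler01 ar1)//; move: h1_ge ar1; lra.
  have N_le : N%:R <= (r ^+ 2) ^+ n.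
    apply: (@le_trans _ _ (M.+1%:R ^+ n)); first by rewrite -natrX ler_nat size_simplex_le.
    by apply: lerXn2r; rewrite ?nnegrE ?sqr_ge0.
  rewrite /G -expRM_natl -expRM_natl -expRD ler_expR mulrN mulr1.
  have NW : N%:R * (3 * eps * r ^+ 2) <= 3 * eps * W.
    rewrite WE [_ ^+ n.+1]exprSr mulrCA ler_wpM2l ?(mulr_ge0 _ (ltW eps_gt0))//.
    by rewrite ler_wpM2r ?sqr_ge0.
  by move: NW Sigma_geR; rewrite /eps; lra.
have [B [mB holeB PB]] :=
  hole_good_cover og oi (expR_gt0 _ : 0 < u) (expR_gt0 _ : 0 < b) r0 rho1 M_le rho_r D8 growth.
have [A [mA smallA PA]] := small_coefficient_prob og [ffun=> 0%N] (expR_gt0 _ : 0 < b).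
pose Z := [set t | exists j, ((@plane R \o omega j) @^-1` outside_disc (u * 2 ^+ total_degree j)) t].
have mZ : measurable Z.
  apply: measurable_exists => j; apply: (measurable_preimage_plane og).
  exact: measurable_outside_disc.
have PZ := large_coefficient_prob og u1; rewrite -/Z in PZ.
have sub : hole omega r `<=` B `|` (A `|` Z).
  move=> t ht; have [tb|tb] := ltP (normc (omega [ffun=> 0%N] t)) b.
    by right; left; exact: smallA.
  have [tZ|nZ] := pselect (Z t); first by right; right.
  left; have small j : normc (omega j t) <= u * 2 ^+ total_degree j.
    rewrite leNgt; apply/negP => big; apply: nZ; exists j.
    rewrite /outside_disc/= -normc_sqr ltrXn2r ?nnegrE ?mulr_ge0 ?exprn_ge0 ?normc_ge0 ?expR_ge0//.
  apply: holeB; split => //; split; first by split.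
  apply: le_trans (small _) _; rewrite /total_degree big1 ?expr0 ?mulr1// => i _.
  by rewrite ffunE.
have mhole : measurable (hole omega r).
  by apply: hole_measurable => // j; exact: (og j).1.
apply: (@le_trans _ _ (P (B `|` (A `|` Z)))).
  by apply: le_measure; rewrite ?inE//; do 2 apply: measurableU => //.
apply: (le_trans (measureU2 _ mB (measurableU _ _ mA mZ))).
have PAZ := measureU2 P mA mZ.
have {PB}PB : (P B <= (expR (- (kappa / 2 * W)))%:E)%E.
  by apply: (le_trans PB); rewrite lee_fin; exact: product_le.
have tail : expR (- (u ^+ 2 / 4)) <= expR (- (2 * W)).
  rewrite ler_expR lerN2 ler_pdivlMr//; apply: (@le_trans _ _ u).
    by rewrite (_ : 2 * W * 4 = 8 * W)//; ring.
  by rewrite expr2 ler_peMr// (le_trans _ u1).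
have b2 : b ^+ 2 = expR (- (2 * W)) by rewrite /b -expRM_natl mulrN.
apply: (@le_trans _ _ ((expR (- (kappa / 2 * W)))%:E + ((4 * b ^+ 2)%:E +
    (2 ^+ (n + 3) * expR (- (u ^+ 2 / 4)))%:E))%E).
  by apply: leeD => //; apply: le_trans PAZ _; exact: leeD.
rewrite -!EFinD lee_fin b2.
have kW : 1 <= kappa / 4 * W.
  have : 4 / kappa <= W by apply: le_trans rk (le_trans r2_ge_r W_ge_r2).
  by rewrite ler_pdivrMr// => h; rewrite mulrAC ler_pdivlMr// mul1r mulrC.
(* The first term is [e1 * e1], and [e1 <= 1 / 2] leaves half of [e1] for the two others. *)
pose e1 := expR (- (kappa / 4 * W)).
have e1_half : e1 <= 2^-1.
  rewrite /e1 expRN lef_pV2 ?posrE ?expR_gt0//.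
  by apply: (le_trans two_le_expR1); rewrite ler_expR.
have e1_0 : 0 <= e1 by exact: expR_ge0.
have first_term : expR (- (kappa / 2 * W)) <= e1 * 2^-1.
  rewrite (_ : expR _ = e1 * e1) ?ler_wpM2l// /e1 -expRD; congr expR.
  by field.
have other_terms : (2 ^+ (n + 3) + 4) * expR (- (2 * W)) <= 2^-1 * e1.
  have -> : - (2 * W) = - W + - W by ring.
  rewrite expRD mulrA; apply: ler_pM; rewrite ?mulr_ge0 ?expR_ge0 ?addr_ge0 ?exprn_ge0//.
    apply: (@le_trans _ _ ((2 ^+ (n + 3) + 4) * W^-1)).
      rewrite ler_wpM2l ?addr_ge0 ?exprn_ge0//; apply: expRN_le_inv.
      exact: lt_le_trans W1.
    rewrite ler_pdivrMr ?(lt_le_trans _ W1)//.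
    by move: rS (le_trans r2_ge_r W_ge_r2); set x := 2 ^+ (n + 3); lra.
  rewrite /e1 ler_expR lerN2 ler_piMl ?(le_trans _ W1)//.
  by move: kappa_le1; lra.
have tail' : 2 ^+ (n + 3) * expR (- (u ^+ 2 / 4)) <= 2 ^+ (n + 3) * expR (- (2 * W)).
  by rewrite ler_wpM2l ?exprn_ge0.
move: first_term other_terms tail'; rewrite -/W -/e1 mulrDl.
set x := 2 ^+ (n + 3) * expR (- (2 * W)); set y := expR (- (2 * W)).
set z := expR (- (kappa / 2 * W)); set v := _ * expR (- (u ^+ 2 / 4)).
by lra.
Qed.

End HoleUpperBound.

Theorem theorem2 (R : realType) (n : nat) (n_ge1 : (1 <= n)%N) :
  exists Rn c1 c2 : R, [/\ 0 < c1, 0 < c2 &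
    forall (d : measure_display) (T : measurableType d) (P : probability T R)
      (omega : multi_index n -> T -> R[i]),
      (forall j : multi_index n, standard_complex_gaussian P (omega j)) ->
      mutually_independent P omega ->
      forall r : R, Rn < r ->
        [/\ measurable (hole omega r),
            ((expR (- (c2 * r ^+ (2 * n + 2))))%:E <= P (hole omega r))%E &
            (P (hole omega r) <= (expR (- (c1 * r ^+ (2 * n + 2))))%:E)%E]].
Proof.
pose a : R := (256 * n%:R ^+ 3)^-1; pose kappa := a ^+ n.+1.
have a0 : 0 < a by rewrite invr_gt0 mulr_gt0 ?exprn_gt0 ?ltr0n.
have kappa0 : 0 < kappa by rewrite exprn_gt0.
have [R1 R1_ge0 R1P] :=
  @power_le_expR_sqr R ((8 * (8 * (52 + n%:R) + 2)) ^+ 2) (kappa / 6) (4 * n + 4)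
    (divr_gt0 kappa0 (ltr0n _ 6)).
have [R2 R2_ge0 R2P] :=
  @power_le_expR_sqr R 8 (kappa / 6) (2 * n + 2) (divr_gt0 kappa0 (ltr0n _ 6)).
pose K : R := 129 * n%:R.
(* A sum of nonnegative thresholds exceeds each of them. *)
exists (1 + 2 * n%:R + 1 / a + 4 / kappa + 2 * (2 ^+ (n + 3) + 4) + R1 + R2),
  (kappa / 4), ((K + 2) ^+ n * (2 * K + 23 + pi) + 1).
have K0 : 0 <= K by rewrite mulr_ge0.
split; first by rewrite divr_gt0.
  have rate0 : 0 <= 2 * K + 23 + pi by have := pi_ge0 R; lra.
  by rewrite ltr_wpDl// mulr_ge0// exprn_ge0// addr_ge0.
move=> d T P omega gaussian indep r.
have n0 : 0 <= 2 * n%:R :> R by rewrite mulr_ge0.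
have a1 : 0 <= 1 / a by rewrite divr_ge0// ltW.
have k1 : 0 <= 4 / kappa by rewrite divr_ge0// ltW.
have p0 : 0 <= 2 * (2 ^+ (n + 3) + 4) :> R by rewrite mulr_ge0 ?addr_ge0 ?exprn_ge0.
move: (1 / a) (4 / kappa) (2 * (2 ^+ (n + 3) + 4)) a1 k1 p0
  (@hole_upper_bound_at R n n_ge1 r) => x y z x0 y0 z0 upper rRn.
have r1 : 1 <= r by lra.
split.
- apply: hole_measurable; last exact: lt_le_trans r1.
  by move=> j; exact: (gaussian j).1.
- exact: hole_lower_bound_at.
- by apply: upper => //; [lra..|apply: R1P => //; lra|apply: R2P => //; lra].
Qed.
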